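(* Let $\Phi:G\times S_{\mathrm{reg}}\to\mathfrak{g}$ be the map $\Phi(g,x)=-\mathrm{Ad}_{g^{-1}}(x)$. If $x\in\mathfrak{g}_{\mathrm{reg}}$, then $\Phi^{-1}(x)$ and its connected components are complex submanifolds of $G\times S_{\mathrm{reg}}$ having dimension $\mathrm{rk}(G)$.
   Context: $G$ is a connected, simply-connected, complex semisimple linear algebraic group of rank $\mathrm{rk}(G)$, with Lie algebra $\mathfrak{g}$ and adjoint representation $\mathrm{Ad}$. For $x\in\mathfrak{g}$, $Z_{\mathfrak{g}}(x)=\{y\in\mathfrak{g}:[x,y]=0\}$; $\mathfrak{g}_{\mathrm{reg}}=\{x\in\mathfrak{g}:\dim Z_{\mathfrak{g}}(x)=\mathrm{rk}(G)\}$ is the set of regular elements (not assumed semisimple). There is exactly one nilpotent adjoint orbit consisting of regular elements, denoted $\mathcal{O}_{\mathrm{reg}}$. Fix a regular $\mathfrak{sl}_2(\mathbb{C})$-triple $(\xi,h,\eta)$ in $\mathfrak{g}$, i.e. $[\xi,\eta]=h$, $[h,\xi]=2\xi$, $[h,\eta]=-2\eta$ with $\xi,\eta\in\mathcal{O}_{\mathrm{reg}}$. The associated Slodowy slice is $S_{\mathrm{reg}}:=\xi+Z_{\mathfrak{g}}(\eta)\subseteq\mathfrak{g}$. *)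

(* Defs.v *)
From HB Require Import structures.
From mathcomp Require Import all_boot all_order all_algebra.
From mathcomp Require Import all_classical all_reals all_analysis.
From mathcomp Require Import complex.
From mathcomp Require mpoly. (* not imported: notation clash with analysis *)

Set Implicit Arguments.
Unset Strict Implicit.
Unset Printing Implicit Defensive.

Import Order.TTheory GRing.Theory Num.Theory.
Import numFieldNormedType.Exports.

Local Open Scope classical_set_scope.
Local Open Scope complex_scope.
Local Open Scope ring_scope.

(* R[i] gets the topology of its modulus, as every numFieldType does through  *)
(* its regular algebra; 'M[R[i]]_n then carries the usual topology of C^(n*n) *)
(* and [differentiable] between normed R[i]-modules is complex Frechet        *)
(* differentiability.                                                         *)
HB.instance Definition _ (R : realType) := NormedModule.copy R[i] R[i]^o.

(* Linear algebraic groups are represented as Zariski-closed subgroups of     *)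
(* GL_n(C), with C = R[i].                                                     *)
Section LinearAlgebraicGroups.
Context {R : realType}.
Local Notation C := R[i].

(* Polynomials in the n * n matrix coefficients, ordered as in [mxvec]. *)
Definition mxmpoly n := mpoly.mpoly (n * n) C.

Definition mxeval n (p : mxmpoly n) (A : 'M[C]_n) : C :=
  mpoly.meval (fun k => mxvec A ord0 k) p.

Definition subgroup_GL n (G : set 'M[C]_n) : Prop :=
  [/\ forall g, G g -> g \in unitmx,
      G 1%:M,
      forall g h, G g -> G h -> G (g *m h)
    & forall g, G g -> G (invmx g)].

Definition zariski_closed_GL n (G : set 'M[C]_n) : Prop :=
  exists I : set (mxmpoly n),
    G = [set g | g \in unitmx /\ forall p, I p -> mxeval p g = 0].

Definition linear_algebraic_group n (G : set 'M[C]_n) : Prop :=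
  subgroup_GL G /\ zariski_closed_GL G.

(* Regular functions on a closed G in GL_n are restrictions of elements of    *)
(* C[x_ij, 1 / det].                                                          *)
Definition regular_map n m (G : set 'M[C]_n) (f : 'M[C]_n -> 'M[C]_m) : Prop :=
  forall i j, exists (p : mxmpoly n) (k : nat),
    forall g, G g -> f g i j = mxeval p g / \det g ^+ k.

Definition algebraic_group_isomorphic n m
    (G : set 'M[C]_n) (H : set 'M[C]_m) : Prop :=
  exists (f : 'M[C]_n -> 'M[C]_m) (f' : 'M[C]_m -> 'M[C]_n),
    [/\ regular_map G f /\ regular_map H f',
        forall g, G g -> H (f g) /\ f' (f g) = g,
        forall h, H h -> G (f' h) /\ f (f' h) = h
      & forall a b, G a -> G b -> f (a *m b) = f a *m f b].

Definition diagonal_group r : set 'M[C]_r :=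
  [set t | t \in unitmx /\ is_diag_mx t].

Definition torus n (T : set 'M[C]_n) (r : nat) : Prop :=
  linear_algebraic_group T /\ algebraic_group_isomorphic T (@diagonal_group r).

Definition maximal_torus n (G T : set 'M[C]_n) (r : nat) : Prop :=
  [/\ torus T r, T `<=` G
    & forall (T' : set 'M[C]_n) (r' : nat),
        torus T' r' -> T' `<=` G -> T `<=` T' -> T' = T].

(* A relation rather than a function; all maximal tori of G are conjugate, so *)
(* at most one r satisfies it.                                                *)
Definition has_rank n (G : set 'M[C]_n) (r : nat) : Prop :=
  exists T, maximal_torus G T r.

Definition derived_subgroup n (G : set 'M[C]_n) : set 'M[C]_n :=
  [set g | forall H : set 'M[C]_n, subgroup_GL H ->
     (forall a b, G a -> G b -> H (a *m b *m invmx a *m invmx b)) -> H g].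

Definition solvable_group n (G : set 'M[C]_n) : Prop :=
  exists k, iter k (@derived_subgroup n) G = [set 1%:M].

(* Triviality of the radical.  [connected] is connectedness for the Euclidean *)
(* topology; on Zariski-closed subgroups of GL_n(C) it agrees with Zariski    *)
(* connectedness.                                                             *)
Definition semisimple_group n (G : set 'M[C]_n) : Prop :=
  forall H : set 'M[C]_n,
    linear_algebraic_group H -> H `<=` G ->
    (forall g h, G g -> H h -> H (g *m h *m invmx g)) ->
    connected H -> solvable_group H ->
    H = [set 1%:M].

End LinearAlgebraicGroups.

Section SimplyConnected.
Variable R : realType.
Local Notation I01 := (`[0 : R, 1]%classic).

Definition path_in (T : topologicalType) (A : set T) (c : R -> T) : Prop :=
  {within I01, continuous c} /\ forall t, I01 t -> A (c t).

Definition path_connected_set (T : topologicalType) (A : set T) : Prop :=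
  A !=set0 /\
  forall a b, A a -> A b -> exists c, [/\ path_in A c, c 0 = a & c 1 = b].

(* Homotopy of loops within A, relative to the base point. *)
Definition null_homotopic (T : topologicalType) (A : set T) (c : R -> T)
    : Prop :=
  exists H : R * R -> T,
    [/\ {within I01 `*` I01, continuous H},
        forall z, (I01 `*` I01) z -> A (H z),
        forall t, I01 t -> H (0, t) = c t,
        forall t, I01 t -> H (1, t) = c 0
      & forall s, I01 s -> H (s, 0) = c 0 /\ H (s, 1) = c 0].

Definition simply_connected (T : topologicalType) (A : set T) : Prop :=
  path_connected_set A /\
  forall c, path_in A c -> c 0 = c 1 -> null_homotopic A c.

End SimplyConnected.

Section LieAlgebra.
Context {R : realType} {n : nat}.
Local Notation C := R[i].
Implicit Type G : set 'M[C]_n.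

(* The Zariski tangent space of G at the identity: the matrices killed by the *)
(* differential at 1 of every polynomial vanishing on G.                      *)
Definition Lie_algebra G : set 'M[C]_n :=
  [set X | forall p : mxmpoly n, (forall g, G g -> mxeval p g = 0) ->
     \sum_(k < n * n) mxeval (mpoly.mderiv k p) 1%:M * mxvec X ord0 k = 0].

Definition Ad (g X : 'M[C]_n) : 'M[C]_n := g *m X *m invmx g.

Definition lie (X Y : 'M[C]_n) : 'M[C]_n := X *m Y - Y *m X.

Definition centralizer_Lie G (x : 'M[C]_n) : set 'M[C]_n :=
  [set y | Lie_algebra G y /\ lie x y = 0].

Definition has_dim (A : set 'M[C]_n) (d : nat) : Prop :=
  exists2 V : {vspace 'M[C]_n}, A = [set y | y \in V] & \dim V = d.

Definition regular_elements G (rk : nat) : set 'M[C]_n :=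
  [set x | Lie_algebra G x /\ has_dim (centralizer_Lie G x) rk].

Definition nilpotent_element G (x : 'M[C]_n) : Prop :=
  Lie_algebra G x /\
  exists k, forall y, Lie_algebra G y -> iter k (lie x) y = 0.

Definition adjoint_orbit G (x : 'M[C]_n) : set 'M[C]_n :=
  [set Ad g x | g in G].

Definition regular_nilpotent_orbit G (rk : nat) (O : set 'M[C]_n) : Prop :=
  (exists2 e, nilpotent_element G e & O = adjoint_orbit G e) /\
  O `<=` regular_elements G rk.

Definition sl2_triple G (xi h eta : 'M[C]_n) : Prop :=
  [/\ Lie_algebra G xi, Lie_algebra G h & Lie_algebra G eta] /\
  [/\ lie xi eta = h, lie h xi = 2 *: xi & lie h eta = - 2 *: eta].

Definition Slodowy_slice G (xi eta : 'M[C]_n) : set 'M[C]_n :=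
  [set xi + y | y in centralizer_Lie G eta].

Definition Phi (p : 'M[C]_n * 'M[C]_n) : 'M[C]_n := - Ad (invmx p.1) p.2.

Definition Phi_fibre G (S : set 'M[C]_n) (x : 'M[C]_n)
    : set ('M[C]_n * 'M[C]_n) :=
  (G `*` S) `&` Phi @^-1` [set x].

End LieAlgebra.

Section ComplexSubmanifolds.
Context {R : realType}.
Local Notation C := R[i].

Definition holomorphic_on (E F : normedModType C) (U : set E) (f : E -> F)
    : Prop :=
  open U /\ forall x, U x -> differentiable f x.

(* phi restricts to a biholomorphism, with inverse psi, from the relatively   *)
(* open subset M `&` U of M (M embedded in E) onto the open subset V of C^m.  *)
Definition holomorphic_chart (E : normedModType C) (M U : set E) (m : nat)
    (V : set 'rV[C]_m) (phi : E -> 'rV[C]_m) (psi : 'rV[C]_m -> E) : Prop :=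
  [/\ holomorphic_on U phi, holomorphic_on V psi,
      forall p, (M `&` U) p -> V (phi p) /\ psi (phi p) = p
    & forall v, V v -> (M `&` U) (psi v) /\ phi (psi v) = v].

(* Around each of its points, A is cut out in a chart of M by the vanishing   *)
(* of all coordinates of index >= k, i.e. it corresponds to C^k x 0.  As      *)
(* usual, the empty set is a submanifold of every dimension.                  *)
Definition complex_submanifold (E : normedModType C) (M A : set E) (k : nat)
    : Prop :=
  A `<=` M /\
  forall p, A p ->
    exists (m : nat) (U : set E) (V : set 'rV[C]_m)
           (phi : E -> 'rV[C]_m) (psi : 'rV[C]_m -> E),
      [/\ holomorphic_chart M U V phi psi, U p, (k <= m)%N
        & forall q, (M `&` U) q ->
            (A q <-> forall j : 'I_m, (k <= j)%N -> phi q ord0 j = 0)].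

End ComplexSubmanifolds.

(* Main.v *)
(** The tangent space to [G] at [g] is [g *m Lie_algebra G], and [Phi] is a
    submersion along its fibres because every [y] in the slice [xi + Z(eta)]
    satisfies [[g, y] + Z(eta) = g].  With [F = ad eta], this follows by
    induction on [k] for [v] in [ker F^k]: sl2-theory gives [v = [xi, a] + b]
    with [a] in [ker F^(k-1)] and [b] in [Z(eta)], and for [y = xi + z] the
    error [[z, a]] stays in [ker F^(k-1)] because [ad z] commutes with [F].
    So the fibre has dimension [dim Z(eta) = rk].

    All maps are polynomial, so they have difference kernels
    [f a - f b = (a - b) *m K a b], and the inverse function theorem reduces to
    the invertibility of [K a a].  To see that [G] is a manifold at the identity,
    choose finitely many [p_i] vanishing on [G] whose differentials at 1 cut
    out the Lie algebra; their zero set is a manifold [Z].  If the [q_k] span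
    the polynomials of bounded degree vanishing on [G], then along a curve in
    [Z] issuing from 1 the derivative of [(q_k)] is bounded by a multiple of
    [(q_k)], since left-invariant derivations preserve the ideal of [G].  By
    Gronwall [q_k = 0] on [Z], i.e. [Z] and [G] agree near 1; no exponential map
    is needed.  Charts whose domain is a ball meet the fibre in a connected set,
    which gives the statement on connected components. *)
Require Import Defs.
From HB Require Import structures.
From mathcomp Require Import all_boot all_order all_algebra.
From mathcomp Require Import all_classical all_reals all_analysis.
From mathcomp Require Import complex.
From mathcomp Require Import ring zify.
From mathcomp Require Import -(notations) mpoly.
Import Order.TTheory GRing.Theory Num.Theory.
Import numFieldNormedType.Exports.
Local Open Scope classical_set_scope.
Local Open Scope complex_scope.
Local Open Scope ring_scope.

Set Implicit Arguments.
Unset Strict Implicit.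
Unset Printing Implicit Defensive.

(** * Norms of matrices and completeness of C *)

(** The inverse function theorem is applied to square systems only, so every set must be cut out by
    exactly as many equations as its codimension. For [G] this is arranged by polynomials whose
    differentials at 1 are linearly independent, for the slice by linear equations annihilating
    [Z(eta)]. The fibre equation, multiplied by the group variable to become polynomial, has [n * n]
    components, in general more than the [d = dim G] conditions it imposes on [G] times the slice;
    it is therefore composed with a projection onto coordinates in the Lie algebra. Nothing is lost
    near the base point: on [G] times the slice the equation says that an element of the Lie
    algebra, translated by a group element close to 1, vanishes, and the projection stays injective
    on such translates.

    The Gronwall step takes place in the ambient matrix space, where a vector tangent to [Z] need
    not be a translate of an element of the Lie algebra. Its transversal component is estimated
    separately and turns out to be of the order of the [q_k]; this is why the degree bound has to
    cover the [p_i] as well. *)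

Section MatrixNorm.
Variable K : numFieldType.

Lemma mx_norm_leP m n (A : 'M[K]_(m, n)) (c : K) : 0 <= c ->
  (forall i j, `|A i j| <= c) -> `|A| <= c.
Proof.
move=> /nonnegP[{}c] Ac; rewrite /Num.norm /= mx_normE num_le.
by apply/bigmax_leP; split => [|ij _]; rewrite -num_le /=.
Qed.

Lemma mx_norm_entry m n (A : 'M[K]_(m, n)) i j : `|A i j| <= `|A|.
Proof.
rewrite [leRHS]/Num.norm /= mx_normE.
have -> : `|A i j| = (`|A i j|%:nng)%:num by [].
rewrite num_le.
by apply: (le_bigmax _ (fun ij : 'I_m * 'I_n => `|A ij.1 ij.2|%:nng) (i, j)).
Qed.

Lemma mulmx_norm m n p (A : 'M[K]_(m, n)) (B : 'M[K]_(n, p)) :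
  `|A *m B| <= n%:R * (`|A| * `|B|).
Proof.
apply: mx_norm_leP => [|i j]; first by rewrite !mulr_ge0.
rewrite mxE; apply: le_trans (ler_norm_sum _ _ _) _.
rewrite (_ : n%:R * _ = \sum_(k < n) (`|A| * `|B|)); last first.
  by rewrite sumr_const card_ord mulr_natl.
rewrite ler_sum // => k _.
by rewrite normrM ler_pM // mx_norm_entry.
Qed.

Lemma linear_bound_continuous (V W : normedModType K) (f : {linear V -> W}) k :
  0 <= k -> (forall x, `|f x| <= k * `|x|) -> continuous f.
Proof.
move=> k0 fk; apply/bounded_linear_continuous/linear_boundedP.
exists k; split=> [|r kr x]; first exact: ger0_real.
by apply: le_trans (fk _) _; rewrite ler_wpM2r // ltW.
Qed.

Lemma continuous_mulmxr m n p (B : 'M[K]_(n, p)) :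
  continuous (mulmxr B : 'M[K]_(m, n) -> 'M[K]_(m, p)).
Proof.
apply: (@linear_bound_continuous _ _ _ (n%:R * `|B|)) => [|A /=].
  by rewrite mulr_ge0.
by apply: le_trans (mulmx_norm _ _) _; rewrite [`|A| * _]mulrC mulrA.
Qed.

Lemma is_diff_littleo (V W : normedModType K) (f : V -> W) (l : {linear V -> W})
    (x : V) : continuous l ->
  (forall e, 0 < e -> exists2 d, 0 < d & forall h, `|h| < d ->
     `|f (h + x) - f x - l h| <= e * `|h|) ->
  is_diff x f l.
Proof.
move=> lc fl.
have fo : f \o shift x = cst (f x) + l +o_ 0 id.
  apply/eqaddoP => _/posnumP[e]; have [d d0 Hd] := fl e%:num [gt0 of e%:num].
  apply/nbhs_norm0P; exists d => //= h hd /=.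
  by rewrite !fctE /= opprD addrA Hd.
have dl := diff_unique lc fo.
by split => //; apply/diff_locallyP; rewrite dl.
Qed.

End MatrixNorm.

Section ComplexComplete.
Variable R : realType.
Local Notation C := R[i].

Lemma normc_ge_Im (z : C) : `|complex.Im z|%:C <= `|z|.
Proof.
rewrite -(mulr1 `|z|) -[X in _ * X](_ : `|'i%C : C| = 1); last first.
  by rewrite normc_def /= expr0n expr1n add0r sqrtr1.
by rewrite -normrM -(normrN (complex.Im z)) -ReiNIm; apply: normc_ge_Re.
Qed.

Lemma normc_real (x : R) : `|x%:C| = `|x|%:C.
Proof. by rewrite normc_def /= expr0n addr0 sqrtr_sqr. Qed.

Lemma normc_le_ReIm (z : C) : `|z| <= (`|complex.Re z| + `|complex.Im z|)%:C.
Proof.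
rewrite {1}[z]complexE rmorphD /=; apply: le_trans (ler_normD _ _) _.
rewrite normrM !normc_real (_ : `|'i%C : C| = 1) ?mul1r //.
by rewrite normc_def /= expr0n expr1n add0r sqrtr1.
Qed.

Lemma gt0_complex (e : C) : 0 < e -> exists2 d : R, 0 < d & e = d%:C.
Proof.
case: e => a b; rewrite ltcE /= => /andP[/eqP -> a0]; exists a => //.
Qed.

Lemma complex_complete (F : set_system C) : ProperFilter F -> cauchy F -> cvg F.
Proof.
move=> FF /cauchy_ballP Fc.
(* Both coordinate functions are additive and 1-Lipschitz, so they send a Cauchy filter to a Cauchy
   filter of reals; [p] stands for either of them. *)
have cReIm (p : C -> R) : (forall z w, p (z - w) = p z - p w) ->
    (forall z, `|p z|%:C <= `|z|) -> cvg (p @ F).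
  move=> pB ple; apply: R_complete; apply/cauchy_ballP => e e0.
  have e0' : 0 < e%:C :> C by rewrite ltcR.
  have [[A B] /= [FA FB] AB] := Fc _ e0'.
  exists (p @` A, p @` B) => /=.
    by split; [apply: filterS FA|apply: filterS FB] => z ? /=; exists z.
  move=> [_ _] /= [[z Az <-] [w Bw <-]]; have := AB (z, w) (conj Az Bw).
  rewrite /= -!ball_normE /= => zw; rewrite -ltcR -pB.
  by apply: le_lt_trans zw; apply: ple.
have /cvg_ex[/= a Ha] : cvg (@complex.Re R @ F).
  by apply: cReIm => [[? ?] [? ?]//|z]; exact: normc_ge_Re.
have /cvg_ex[/= b Hb] : cvg (@complex.Im R @ F).
  by apply: cReIm => [[? ?] [? ?]//|z]; exact: normc_ge_Im.
apply/cvg_ex; exists (a +i* b); apply/cvgrPdist_lt => _ /gt0_complex[e e0 ->].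
have e2 : 0 < e / 2 by rewrite divr_gt0.
move/cvgrPdist_lt/(_ _ e2): Ha => Ha; move/cvgrPdist_lt/(_ _ e2): Hb => Hb.
near=> z; apply: le_lt_trans (normc_le_ReIm _) _.
rewrite ltcR [ltRHS]splitr ltrD //.
  rewrite (_ : complex.Re _ = a - complex.Re z); first by near: z.
  by case: (z).
rewrite (_ : complex.Im _ = b - complex.Im z); first by near: z.
by case: (z).
Unshelve. all: by end_near. Qed.

End ComplexComplete.

(** Completeness of [R[i]] passes to matrices, which gives the iteration of the inverse function
    theorem its limit. *)
HB.instance Definition _ (R : realType) :=
  Uniform_isComplete.Build R[i] (@complex_complete R).

(** * Inverse function theorem *)

Section InverseFunction.
Variable R : realType.
Local Notation C := R[i].

(** Vectors are rows, so [K a a] is the transposed Jacobian of [f] at [a]. Joint continuity is asked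
    on the diagonal only: this is strict differentiability, which the inverse function theorem
    needs. *)
Definition difference_kernel N N' (f : 'rV[C]_N -> 'rV[C]_N')
    (K : 'rV[C]_N -> 'rV[C]_N -> 'M[C]_(N, N')) : Prop :=
  (forall a b, f a - f b = (a - b) *m K a b) /\
  (forall a e, 0 < e -> exists2 d, 0 < d & forall b c,
     `|b - a| < d -> `|c - a| < d -> `|K b c - K a a| < e).

Lemma geometric_cvg N (u : nat -> 'rV[C]_N) (c : C) :
  (forall k, `|u k.+1 - u k| <= c / 2 ^+ k) -> cvg (u @ \oo).
Proof.
move=> uc; have c0 : 0 <= c by have := uc 0%N; rewrite divr1; apply: le_trans.
(* The geometric tail is kept in closed form so that the induction on [m] telescopes. *)
have um k m : `|u (m + k)%N - u k| <= 2 * c / 2 ^+ k - 2 * c / 2 ^+ (m + k).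
  elim: m => [|m IH]; first by rewrite add0n !subrr normr0.
  rewrite -(subrKA (u (m + k)%N)); apply: le_trans (ler_normD _ _) _.
  apply: le_trans (lerD (uc _) IH) _; rewrite addrCA lerD2l addSn exprS.
  have x0 : (2 : C) ^+ (m + k) != 0 by rewrite expf_neq0 // pnatr_eq0.
  by rewrite le_eqVlt; apply/orP; left; apply/eqP; field.
apply: mx_complete; apply/cauchy_exP => _ /gt0_complex[e e0 ->].
have [c' c'0 cE] : exists2 c' : R, 0 <= c' & c = c'%:C.
  by case: c c0 {uc um} => a b; rewrite lecE /= => /andP[/eqP-> a0]; exists a.
(* An archimedean bound suffices because [k < 2 ^ k]. *)
pose k := Num.bound (2 * c' / e).
exists (u k); exists k => // m /= km; rewrite -(subnK km) -ball_normE /=.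
rewrite distrC; apply: le_lt_trans (um _ _) _.
apply: (@le_lt_trans _ _ (2 * c / 2 ^+ k)).
  by rewrite gerBl divr_ge0 ?mulr_ge0 ?exprn_ge0.
rewrite ltr_pdivrMr ?exprn_gt0 // cE.
rewrite (_ : 2 * _ = (2 * c')%:C); last by rewrite rmorphM rmorph_nat.
rewrite (_ : (2 : C) ^+ k = (2 ^+ k)%:C); last by rewrite rmorphXn rmorph_nat.
rewrite -rmorphM /= ltcR [ltRHS]mulrC -ltr_pdivrMr //.
apply: lt_trans (archi_boundP _) _; first by rewrite divr_ge0 ?mulr_ge0 // ltW.
by rewrite -natrX ltr_nat ltn_expl.
Qed.

Lemma kernel_continuous N N' (f : 'rV[C]_N -> 'rV[C]_N') K :
  difference_kernel f K -> continuous f.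
Proof.
move=> [fK Kc] a; apply/(@cvgrPdist_lt _ _ _ (nbhs a)) => e e0.
have [d d0 Kd] := Kc a 1 ltr01.
have k0 : 0 < N%:R * (`|K a a| + 1) + 1 :> C.
  by rewrite ltr_wpDl // mulr_ge0 // addr_ge0.
near=> b; rewrite fK; apply: le_lt_trans (mulmx_norm _ _) _.
have bd : `|b - a| < d by rewrite distrC; near: b; apply: cvgr_dist_lt => //.
have ad : `|a - a| < d by rewrite subrr normr0.
have Kab : `|K a b| <= `|K a a| + 1.
  rewrite -[K a b](subrK (K a a)) addrC; apply: le_trans (ler_normD _ _) _.
  by rewrite lerD2l ltW // Kd.
apply: (@le_lt_trans _ _ (`|a - b| * (N%:R * (`|K a a| + 1) + 1))).
  rewrite mulrCA ler_wpM2l // ler_wpDr // ler_wpM2l //.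
rewrite -ltr_pdivlMr //; near: b; apply: cvgr_dist_lt => //.
by rewrite divr_gt0.
Unshelve. all: by end_near. Qed.

Lemma normr_le_eps (V : normedModType C) (v : V) (y : C) : 0 <= y ->
  (forall e, 0 < e -> `|v| <= y + e) -> `|v| <= y.
Proof.
move=> y0 H; case: (real_leP (ger0_real (normr_ge0 v)) (ger0_real y0)) => // yv.
have := H ((`|v| - y) / 2); rewrite divr_gt0 ?subr_gt0 // => /(_ isT).
rewrite -lerBlDl -subr_ge0 (_ : _ - _ = (y - `|v|) / 2); last by field.
by rewrite pmulr_lge0 ?invr_gt0 // subr_ge0 lt_geF.
Qed.

(** The order of [C] is partial, but positive elements are real and hence comparable. *)
Lemma exists_min (a b : C) : 0 < a -> 0 < b ->
  exists c, [/\ 0 < c, c <= a & c <= b].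
Proof.
move=> a0 b0; have /orP[ab|ba] := real_leVge (gtr0_real a0) (gtr0_real b0).
  by exists a.
by exists b.
Qed.

(** Newton's iteration with the fixed matrix [J] in place of the varying inverse derivative. The
    dimensions [N] and [N'] have separate names, although [J] forces them to be equal, so that sums
    of block sizes can be used without casts. The set [O] carries the further conditions that a
    caller wants on the domain. *)
Theorem inverse_function N N' (f : 'rV[C]_N -> 'rV[C]_N') K (p : 'rV[C]_N)
    (J : 'M[C]_(N', N)) (O : set 'rV[C]_N) :
  difference_kernel f K -> K p p *m J = 1%:M -> J *m K p p = 1%:M ->
  nbhs p O ->
  exists (U : set 'rV[C]_N) (e : C) (g : 'rV[C]_N' -> 'rV[C]_N),
    [/\ [/\ open U, U p, U `<=` O & 0 < e],
        forall a, U a -> `|f p - f a| < e /\ g (f a) = a,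
        forall w, `|f p - w| < e -> U (g w) /\ f (g w) = w
      & forall w, `|f p - w| < e -> exists2 D : 'M[C]_(N', N),
          D *m K (g w) (g w) = 1%:M & is_diff w g (mulmxr D)].
Proof.
move=> fKc KJ JK; have fc := kernel_continuous fKc; case: fKc => fK Kc.
move=> /nbhs_ballP[r0 r00]; rewrite -ball_normE => r0O.
pose c : C := N'%:R * `|J|; have c0 : 0 <= c by rewrite mulr_ge0.
(* Small enough for [1 - K a b *m J] to halve norms on the ball of radius [r]; the [+ 1] keeps the
   denominator positive when [J] is 0. *)
pose d1 : C := (2 * (N%:R * (N'%:R * `|J|) + 1))^-1.
have d10 : 0 < d1 by rewrite invr_gt0 mulr_gt0 // ltr_wpDl // !mulr_ge0.
have [r [r_gt0 rr0 Kr]] : exists r : C, [/\ 0 < r, r <= r0 &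
    forall a b, `|a - p| < r -> `|b - p| < r -> `|K a b - K p p| < d1].
  have [d d0 Kd] := Kc p d1 d10.
  have [r [r_gt0 rr0 rd]] := exists_min r00 d0.
  by exists r; split=> // a b ap bp; apply: Kd; apply: lt_le_trans rd.
pose B a := `|a - p| < r.
have contr a b (v : 'rV_N) : B a -> B b -> `|v - v *m K a b *m J| <= `|v| / 2.
  move=> Ba Bb; rewrite -{1}[v]mulmx1 -KJ -mulmxA -mulmxBr -mulmxBl.
  apply: le_trans (mulmx_norm _ _) _; rewrite mulrCA ler_wpM2l //.
  apply: (@le_trans _ _ (N%:R * (N'%:R * (d1 * `|J|)))).
    rewrite ler_wpM2l //; apply: le_trans (mulmx_norm _ _) _.
    by rewrite ler_wpM2l // ler_wpM2r // distrC ltW // Kr.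
  pose X : C := N%:R * (N'%:R * `|J|).
  have X0 : 0 <= X by rewrite !mulr_ge0.
  have -> : N%:R * (N'%:R * (d1 * `|J|)) = X / (2 * (X + 1)).
    by rewrite /d1 -/X; move: (_^-1) => i; rewrite /X; ring.
  rewrite ler_pdivrMr ?mulr_gt0 ?ltr_wpDl // mulrA mulVf ?pnatr_eq0 // mul1r.
  by rewrite lerDl.
have lip a b : B a -> B b -> `|a - b| <= 2 * c * `|f a - f b|.
  move=> Ba Bb; have H := contr a b (a - b) Ba Bb.
  have H2 : `|a - b| <= `|a - b| / 2 + c * `|f a - f b|.
    rewrite -{1}(subrK ((a - b) *m K a b *m J) (a - b)).
    apply: le_trans (ler_normD _ _) _; apply: lerD => //.
    rewrite -fK; apply: le_trans (mulmx_norm _ _) _.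
    by rewrite mulrCA mulrC.
  move: H2; rewrite -lerBlDl (_ : _ - _ / 2 = `|a - b| / 2); last by field.
  rewrite ler_pdivrMr //.
  by rewrite -mulrA [2 * _]mulrC.
(* The first step of the iteration is at most [c * e <= r / 4]; as the steps are halved each time,
   the whole orbit stays within [r / 2] of [p]. *)
pose e : C := r / (4 * (c + 1)).
have c10 : 0 < c + 1 by rewrite ltr_wpDl.
have e0 : 0 < e by rewrite divr_gt0 // mulr_gt0.
have ce : c * e <= r / 4.
  have -> : c * e = r / 4 * (c / (c + 1)).
    by rewrite /e; field; rewrite gt_eqF.
  rewrite ler_piMr //; first by rewrite divr_ge0 // ltW.
  by rewrite ler_pdivrMr // mul1r lerDl.
pose T w a := a - (f a - w) *m J.
pose u w := fix u k := if k is k'.+1 then T w (u k') else p.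
have Tcontr w a b : B a -> B b -> `|T w a - T w b| <= `|a - b| / 2.
  move=> Ba Bb; rewrite /T; apply: le_trans (contr a b (a - b) Ba Bb).
  rewrite -fK le_eqVlt; apply/orP; left; apply/eqP; congr `|_|.
  rewrite !mulmxBl; move: (f a *m J) (f b *m J) (w *m J) => u1 u2 u3.
  by apply/rowP => i; rewrite !mxE; ring.
have uE w : `|f p - w| < e -> forall k,
    `|u w k - p| <= r / 2 - r / 2 / 2 ^+ k /\
    `|u w k.+1 - u w k| <= r / 4 / 2 ^+ k.
  move=> we.
  have uB k : `|u w k - p| <= r / 2 - r / 2 / 2 ^+ k -> B (u w k).
    move=> H; apply: le_lt_trans H _; apply: (@lt_trans _ _ (r / 2)).
      by rewrite gtrBl !divr_gt0 ?exprn_gt0.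
    by rewrite ltr_pdivrMr // ltr_pMr // ltr1n.
  elim=> [|k [IH1 IH2]].
    rewrite expr0 !divr1 !subrr normr0 lexx; split => //=.
    rewrite /T addrC addKr normrN; apply: le_trans (mulmx_norm _ _) _.
    rewrite mulrCA mulrC; apply: le_trans ce.
    by rewrite ler_wpM2l // ltW.
  have H1 : `|u w k.+1 - p| <= r / 2 - r / 2 / 2 ^+ k.+1.
    rewrite -(subrKA (u w k)); apply: le_trans (ler_normD _ _) _.
    apply: le_trans (lerD IH2 IH1) _; rewrite exprS.
    have x0 : (2 : C) ^+ k != 0 by rewrite expf_neq0 // pnatr_eq0.
    by rewrite le_eqVlt; apply/orP; left; apply/eqP; field.
  split => //.
  apply: le_trans (Tcontr w _ _ (uB _ H1) (uB _ IH1)) _.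
  by rewrite exprS invfM mulrA mulrAC ler_wpM2r // invr_ge0.
(* The limit of the iteration; [p] is a default value for [w] outside the ball, so that [choice]
   yields a total [g]. *)
have lE w : exists l, `|f p - w| < e -> B l /\ f l = w.
  have [we|_] := boolP (`|f p - w| < e); last by exists p.
  have uw := uE w we.
  have /cvg_ex[/= l ul] : cvg (u w @ \oo).
    apply: (@geometric_cvg _ _ (r / 4)) => k; exact: (uw k).2.
  exists l => _.
  have ule e1 : 0 < e1 -> \forall k \near \oo, `|l - u w k| < e1.
    by move=> e10; move/cvgrPdist_lt: ul; apply.
  have uB k : `|u w k - p| <= r / 2.
    by apply: le_trans (uw k).1 _; rewrite gerBl !divr_ge0 ?exprn_ge0 // ltW.
  have r2 : r / 2 < r by rewrite ltr_pdivrMr // ltr_pMr // ltr1n.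
  have lp : B l.
    rewrite /B; apply: le_lt_trans r2; apply: normr_le_eps => [|e1 e10].
      by rewrite divr_ge0 // ltW.
    have [k _ /(_ k (leqnn _)) /= lk] := ule _ e10.
    rewrite -(subrKA (u w k)) addrC; apply: le_trans (ler_normD _ _) _.
    by rewrite lerD // ltW.
  split=> //.
  have TlE : T w l = l.
    apply/eqP; rewrite -subr_eq0 -normr_le0; apply: normr_le_eps => // e1 e10.
    have e20 : 0 < e1 / 2 by rewrite divr_gt0.
    have [k _ lk] := ule _ e20; have lk1 := lk k.+1 (leqW (leqnn k)).
    have := lk k (leqnn _) => /= {}lk; rewrite -(subrKA (u w k.+1)) add0r.
    apply: le_trans (ler_normD _ _) _; apply: le_trans (lerD _ _) (_ : e1 / 2 + e1 / 2 <= _).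
    - apply: le_trans (Tcontr w _ _ lp (le_lt_trans (uB k) r2)) _.
      by apply: le_trans (ltW lk); rewrite ler_pdivrMr // ler_peMr // ler1n.
    - by rewrite distrC; apply: ltW.
    - by rewrite -splitr.
  have : (f l - w) *m J = 0.
    by move: TlE; rewrite /T => /(congr1 (fun z => l - z)); rewrite subKr subrr.
  move=> /(congr1 (mulmxr (K p p))) /=; rewrite -mulmxA JK mulmx1 mul0mx.
  by move/eqP; rewrite subr_eq0 => /eqP.
have /choice[g gE] := lE.
(* Intersecting with the preimage of the [e]-ball makes [f] a bijection from this open set onto that
   ball. *)
exists [set a | B a /\ `|f p - f a| < e], e, g; split.
- split => //.
  + have -> : [set a | B a /\ `|f p - f a| < e] =
        ball p r `&` f @^-1` (ball (f p) e).
      by rewrite -!ball_normE /B; apply/seteqP; split=> a /=; rewrite distrC.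
    apply: openI; first exact: ball_open.
    by apply: open_comp => [? ? |]; [exact: fc|exact: ball_open].
  + by rewrite /B /= !subrr !normr0.
  + move=> a [Ba _]; apply: r0O => /=; rewrite distrC.
    exact: (lt_le_trans (Ba : `|a - p| < r) rr0).
- move=> a [Ba fa]; split=> //; have [Bg fg] := gE _ fa.
  have := lip _ _ Bg Ba; rewrite fg subrr normr0 mulr0 normr_le0.
  by rewrite subr_eq0 => /eqP.
- by move=> w we; have [Bg fg] := gE w we; split=> //; split=> //=; rewrite fg.
- move=> w0 we; have [Bb fb] := gE w0 we; set b := g w0 in Bb fb *.
  (* By [contr] on the diagonal, [K b b *m J] moves a vector by at most half its norm, so it kills
     only 0; then [J *m invmx Q] inverts [K b b] on both sides. *)
  have Qu : K b b *m J \in unitmx.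
    rewrite -row_free_unit; apply: inj_row_free => v.
    rewrite mulmxA => v0; have := contr b b v Bb Bb.
    rewrite v0 subr0; have [->//|v1] := eqVneq v 0.
    rewrite ler_pdivlMr // -subr_ge0 mulr_natr mulr2n opprD addrA subrr sub0r.
    by rewrite oppr_ge0 normr_le0 (negbTE v1).
  set Q := K b b *m J in Qu.
  exists (J *m invmx Q).
    have -> : K b b = Q *m K p p by rewrite /Q -mulmxA JK mulmx1.
    by rewrite -mulmxA (mulmxA (invmx Q)) mulVmx // mul1mx JK.
  have KD : K b b *m (J *m invmx Q) = 1%:M by rewrite mulmxA mulmxV.
  set D := J *m invmx Q in KD *.
  apply: is_diff_littleo; first exact: continuous_mulmxr.
  move=> e1 e10.
  pose m : C := N%:R * (2 * c * (N'%:R * `|D|)) + 1.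
  have m0 : 0 < m by rewrite ltr_wpDl // !mulr_ge0.
  have [d d0 Kd] := Kc b (e1 / m) (divr_gt0 e10 m0).
  have we' : 0 < e - `|f p - w0| by rewrite subr_gt0.
  have c20 : 0 < 2 * c + 1 by rewrite ltr_wpDl // mulr_ge0.
  have [d' [d'0 d'e d'd]] := exists_min we' (divr_gt0 d0 c20).
  exists d' => // h hd.
  have hwe : `|f p - (h + w0)| < e.
    rewrite opprD addrCA addrC; apply: le_lt_trans (ler_normD _ _) _.
    by rewrite normrN -ltrBrDl (lt_le_trans hd).
  have [Ba fa] := gE _ hwe; set a := g (h + w0) in Ba fa *.
  have hE : h = f a - f b by rewrite fa fb addrK.
  have ab : `|a - b| <= 2 * c * `|h| by rewrite hE; exact: lip.
  have abd : `|a - b| < d.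
    apply: le_lt_trans ab _; have := lt_le_trans hd d'd.
    rewrite ltr_pdivlMr //; apply: le_lt_trans.
    by rewrite mulrC ler_wpM2l // lerDl.
  (* With [h = (a - b) *m K a b] and [K b b *m D = 1], the remainder factors as
     [(a - b) *m (K b b - K a b) *m D]: one factor is [O(h)] by the Lipschitz bound, the other tends
     to 0. *)
  rewrite /= {1}hE fK (_ : _ - _ = (a - b) *m (K b b - K a b) *m D); last first.
    by rewrite -{1}[a - b]mulmx1 -KD mulmxA -mulmxBl -mulmxBr.
  rewrite -mulmxA; apply: le_trans (mulmx_norm _ _) _.
  have bb : `|b - b| < d by rewrite subrr normr0.
  have KB : `|(K b b - K a b) *m D| <= N'%:R * (e1 / m * `|D|).
    apply: le_trans (mulmx_norm _ _) _; rewrite ler_wpM2l // ler_wpM2r //.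
    by rewrite distrC ltW // Kd.
  apply: (@le_trans _ _ (N%:R * ((2 * c * `|h|) * (N'%:R * (e1 / m * `|D|))))).
    by rewrite ler_wpM2l // ler_pM.
  rewrite (_ : N%:R * _ = (m - 1) * (e1 / m * `|h|)); last first.
    by rewrite /m addrK; ring.
  rewrite mulrA ler_wpM2r // mulrCA ler_piMr // ?ltW //.
  by rewrite ltr_pdivrMr // mul1r gtrBl.
Qed.
End InverseFunction.

(** * Difference kernels of polynomials *)

Section PolynomialKernel.
Variable R : realType.
Local Notation C := R[i].

Lemma mpoly_ring_ind N (P : mpoly N C -> Prop) :
  (forall c, P (mpolyC N c)) -> (forall i, P (mpolyX C (mnm1 i))) ->
  (forall p q, P p -> P q -> P (p + q)) ->
  (forall p q, P p -> P q -> P (p * q)) -> forall p, P p.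
Proof.
move=> PC PX PD PM; apply: mpolyind => [|c m p _ _ Pp]; first by rewrite -mpolyC0.
apply: (PD) => //; rewrite -mul_mpolyC; apply: (PM) => //.
rewrite mpolyXE_id; elim/big_ind: _ => [|p1 q1|i _]; [by rewrite -mpolyC1|exact: PM|].
elim: (m i) => [|k IH]; first by rewrite expr0 -mpolyC1.
by rewrite exprS; apply: (PM).
Qed.

(** The scalar version, with the gradient [df] recorded. Continuity of [f] is included because the
    kernel of a product contains the values of its factors. *)
Definition has_kernel N (f : 'rV[C]_N -> C) (df : 'rV[C]_N -> 'cV[C]_N) : Prop :=
  continuous f /\ exists k : 'rV[C]_N -> 'rV[C]_N -> 'cV[C]_N,
    [/\ forall a b, f a - f b = ((a - b) *m k a b) ord0 ord0,
        forall a, k a a = df a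
      & forall a, k z.1 z.2 @[z --> (a, a)] --> df a].

Lemma has_kernel_eq N f g df dg : f =1 g -> df =1 dg ->
  @has_kernel N f df -> has_kernel g dg.
Proof. by move=> /funext <- /funext <-. Qed.

Lemma has_kernel_cst N (c : C) : has_kernel (fun _ : 'rV[C]_N => c) (fun=> 0).
Proof.
split; first by move=> ?; apply: cst_continuous.
exists (fun _ _ => 0); split=> // [a b|a]; last exact: cvg_cst.
by rewrite subrr mulmx0 mxE.
Qed.

Lemma has_kernel_lin N (T : 'cV[C]_N) :
  has_kernel (fun a : 'rV[C]_N => (a *m T) ord0 ord0) (fun=> T).
Proof.
split=> [a|].
  apply: (@continuous_comp _ _ _ (mulmxr T : 'rV[C]_N -> 'rV[C]_1)
    (fun M => M ord0 ord0)); first exact: continuous_mulmxr.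
  exact: coord_continuous.
exists (fun _ _ => T); split=> // [a b|a]; last exact: cvg_cst.
by rewrite mulmxBl !mxE.
Qed.

Lemma has_kernelD N f g df dg : @has_kernel N f df -> has_kernel g dg ->
  has_kernel (fun a => f a + g a) (fun a => df a + dg a).
Proof.
move=> [fc [k [fk kd kc]]] [gc [l [gl ld lc]]]; split=> [a|].
  exact: (cvgD (fc a) (gc a)).
exists (fun a b => k a b + l a b); split=> [a b|a|a].
- by rewrite opprD addrACA fk gl mulmxDr !mxE.
- by rewrite kd ld.
- exact: cvgD (kc a) (lc a).
Qed.

(** From [f a * g a - f b * g b = g a * (f a - f b) + f b * (g a - g b)]. *)
Lemma has_kernelM N f g df dg : @has_kernel N f df -> has_kernel g dg ->
  has_kernel (fun a => f a * g a) (fun a => g a *: df a + f a *: dg a).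
Proof.
move=> [fc [k [fk kd kc]]] [gc [l [gl ld lc]]]; split=> [a|].
  exact: (cvgM (fc a) (gc a)).
exists (fun a b => g a *: k a b + f b *: l a b); split=> [a b|a|a].
- rewrite mulmxDr -!scalemxAr !mxE.
  by move: (fk a b) (gl a b); rewrite !mxE => <- <-; ring.
- by rewrite kd ld.
- have g1 : g z.1 @[z --> (a, a)] --> g a.
    by apply: (@cvg_comp _ _ _ fst g); [exact: cvg_fst|exact: gc].
  have f2 : f z.2 @[z --> (a, a)] --> f a.
    by apply: (@cvg_comp _ _ _ snd f); [exact: cvg_snd|exact: fc].
  exact: (cvgD (cvgZ g1 (kc a)) (cvgZ f2 (lc a))).
Qed.

Lemma has_kernel_comp N M (T : 'M[C]_(N, M)) f df : has_kernel f df ->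
  has_kernel (fun a : 'rV[C]_N => f (a *m T)) (fun a => T *m df (a *m T)).
Proof.
have Tc := @continuous_mulmxr _ 1 _ _ T.
move=> [fc [k [fk kd kc]]]; split=> [a|].
  exact: (@continuous_comp _ _ _ (mulmxr T) f a (Tc a) (fc _)).
exists (fun a b => T *m k (a *m T) (b *m T)); split=> [a b|a|a].
- by rewrite fk -mulmxBl mulmxA.
- by rewrite kd.
have Lc : continuous (mulmx T : 'cV[C]_M -> 'cV[C]_N).
  apply: (@linear_bound_continuous _ _ _ _ (M%:R * `|T|)) => [|A].
    by rewrite mulr_ge0.
  by rewrite -mulrA mulmx_norm.
have T1 : z.1 *m T @[z --> (a, a)] --> a *m T.
  by apply: (@cvg_comp _ _ _ fst (mulmxr T)); [exact: cvg_fst|exact: Tc].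
have T2 : z.2 *m T @[z --> (a, a)] --> a *m T.
  by apply: (@cvg_comp _ _ _ snd (mulmxr T)); [exact: cvg_snd|exact: Tc].
have T12 : (z.1 *m T, z.2 *m T) @[z --> (a, a)] --> (a *m T, a *m T).
  exact: cvg_pair T1 T2.
have kT := cvg_comp _ _ T12 (kc (a *m T)).
exact: (cvg_comp _ _ kT (Lc _)).
Qed.

(** A kernel is not determined by [f], but its diagonal is: along the line [a + t e_i] the [i]-th
    entry of any kernel is the difference quotient, and [t] tends to 0. *)
Lemma has_kernel_unique N f df dg : @has_kernel N f df -> has_kernel f dg ->
  df =1 dg.
Proof.
move=> [_ [k [fk _ kc]]] [_ [l [fl _ lc]]] a; apply/colP => i.
pose u (t : C) := a + t *: delta_mx ord0 i.
have uc : u t @[t --> (0 : C)^'] --> a.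
  have u0 : u t @[t --> (0 : C)] --> a + 0 *: delta_mx ord0 i.
    have ac : (fun=> a) @ (0 : C) --> a by apply: cst_continuous.
    have sc : (t *: delta_mx ord0 i : 'rV[C]_N) @[t --> (0 : C)] -->
        (0 *: delta_mx ord0 i : 'rV[C]_N) by exact: scalel_continuous.
    exact: (cvgD ac sc).
  rewrite scale0r addr0 in u0; apply: cvg_trans u0; apply: cvg_app.
  exact: cvg_within.
have lim (k1 : 'rV[C]_N -> 'rV[C]_N -> 'cV[C]_N) (d : 'cV[C]_N) :
    k1 z.1 z.2 @[z --> (a, a)] --> d ->
    k1 (u t) a i ord0 @[t --> (0 : C)^'] --> d i ord0.
  move=> kd.
  have u2 : (u t, a) @[t --> (0 : C)^'] --> (a, a).
    have ac : a @[t --> (0 : C)^'] --> a by apply: cvg_cst.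
    by apply: cvg_pair uc ac.
  have := cvg_comp _ _ u2 kd => /= kd2.
  exact: (cvg_comp _ _ kd2 (@coord_continuous _ _ _ i ord0 d)).
apply: (@cvg_unique _ (@norm_hausdorff _ _) _ _ _ _ (lim k _ (kc a))).
apply: cvg_trans (lim l _ (lc a)); apply: near_eq_cvg.
near=> t.
have t0 : t != 0 by near: t; exact: nbhs_dnbhs_neq.
have : ((u t - a) *m k (u t) a) ord0 ord0 = ((u t - a) *m l (u t) a) ord0 ord0.
  by rewrite -fk -fl.
rewrite /u addrC addKr -!scalemxAl -!rowE !mxE.
by move/(mulfI t0).
Unshelve. all: by end_near. Qed.

Definition peval N (p : mpoly N C) (a : 'rV[C]_N) : C := meval (fun k => a ord0 k) p.

Definition pgrad N (p : mpoly N C) (a : 'rV[C]_N) : 'cV[C]_N :=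
  \col_i peval (mderiv i p) a.

Lemma pgradE N (p : mpoly N C) a i : pgrad p a i ord0 = peval (mderiv i p) a.
Proof. by rewrite mxE. Qed.

Lemma peval_has_kernel N (p : mpoly N C) : has_kernel (peval p) (pgrad p).
Proof.
elim/mpoly_ring_ind: p => [c|i|p q Hp Hq|p q Hp Hq].
- apply: has_kernel_eq (has_kernel_cst N c) => a; first by rewrite /peval mevalC.
  by apply/colP => i; rewrite !mxE mderivC /peval meval0.
- apply: has_kernel_eq (has_kernel_lin (delta_mx i ord0)) => a.
    by rewrite -colE mxE /peval mevalXU.
  apply/colP => j; rewrite !mxE andbT /peval mderivX mevalZ mnm1E eq_sym.
  have [->|_] := eqVneq j i; last by rewrite mul0r.
  by rewrite mul1r -{1}[mnm1 i]add0m addmK mpolyX0 meval1.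
- apply: has_kernel_eq (has_kernelD Hp Hq) => a.
    by rewrite /peval mevalD.
  by apply/colP => j; rewrite mxE !pgradE mderivD /peval mevalD.
- apply: has_kernel_eq (has_kernelM Hp Hq) => a.
    by rewrite /peval mevalM.
  apply/colP => j; rewrite mxE [X in X + _]mxE [X in _ + X]mxE !pgradE mderivM.
  by rewrite /peval mevalD !mevalM mulrC.
Qed.

Lemma peval_linear_comp N M (p : mpoly M C) (T : 'M[C]_(N, M)) :
  exists q : mpoly N C, forall a, peval q a = peval p (a *m T).
Proof.
exists (comp_mpoly [tuple \sum_l T l k *: mpolyX C (mnm1 l) | k < M] p) => a.
rewrite /peval comp_mpoly_meval; apply: meval_eq => k.
rewrite tnth_mktuple raddf_sum mxE; apply: eq_bigr => l _.
by rewrite /= mevalZ mevalXU mulrC.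
Qed.

(** The chain rule comes from uniqueness of the gradient, without differentiating the composed
    polynomial formally. *)
Lemma pgrad_linear_comp N M (p : mpoly M C) (q : mpoly N C) (T : 'M[C]_(N, M)) :
  (forall a, peval q a = peval p (a *m T)) ->
  forall a, pgrad q a = T *m pgrad p (a *m T).
Proof.
move=> qE; apply: has_kernel_unique (peval_has_kernel q) _.
apply: has_kernel_eq (has_kernel_comp T (peval_has_kernel p)) => // a.
Qed.

End PolynomialKernel.

(** * Gronwall lemma *)

Section Gronwall.
Variable R : realType.
Local Notation C := R[i].

Lemma is_derive_ReIm (p : C -> R) (w : R -> C) (t : R) (l : C) :
  (forall z w, p (z - w) = p z - p w) ->
  (forall (x : R) z, p (x%:C * z) = x * p z) ->
  (forall z, `|p z|%:C <= `|z|) ->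
  (s%:C)^-1 * (w (s + t) - w t) @[s --> (0 : R)^'] --> l ->
  is_derive t (1 : R) (p \o w) (p l).
Proof.
move=> pB pZ ple wl.
have pc : p @ l --> p l.
  apply/(@cvgrPdist_lt _ _ _ (nbhs l)) => e e0; near=> z.
  rewrite -ltcR -pB; apply: le_lt_trans (ple _) _.
  by near: z; apply: cvgr_dist_lt => //; rewrite ltcR.
have H : s^-1 *: ((p \o w \o shift t) (s *: 1) - (p \o w) t) @[s --> (0 : R)^']
    --> p l.
  apply: cvg_trans (cvg_comp _ _ wl pc); apply: near_eq_cvg; near=> s.
  by rewrite /= -fmorphV pZ pB /GRing.scale /= mulr1.
split; first by apply/cvg_ex; exists (p l).
exact: (cvg_lim (@norm_hausdorff _ _) H).
Unshelve. all: by end_near. Qed.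

Lemma Re_realM (x : R) (z : C) : complex.Re (x%:C * z) = x * complex.Re z.
Proof. by case: z => a b /=; rewrite mul0r subr0. Qed.

Lemma Im_realM (x : R) (z : C) : complex.Im (x%:C * z) = x * complex.Im z.
Proof. by case: z => a b /=; rewrite mul0r addr0. Qed.

Definition normsq (z : C) : R := complex.Re z ^+ 2 + complex.Im z ^+ 2.

Lemma normsqE (z : C) : `|z| ^+ 2 = (normsq z)%:C.
Proof. by rewrite -add_Re2_Im2. Qed.

Lemma normsq_dot (z w : C) (r : R) : `|w| <= r%:C ->
  complex.Re z * complex.Re w + complex.Im z * complex.Im w <=
    complex.Re `|z| * r.
Proof.
move=> wr.
have -> : complex.Re z * complex.Re w + complex.Im z * complex.Im w =
    complex.Re (z * w^*%C).
  by case: z => a b; case: w {wr} => u v /=; rewrite mulrN opprK.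
apply: le_trans (ler_norm _) _; rewrite -lecR.
apply: le_trans (normc_ge_Re _) _; rewrite normrM normcJ.
have zE : (complex.Re `|z|)%:C = `|z| by rewrite RRe_real ?normr_real.
by rewrite (rmorphM (real_complex R)) [X in _ <= X * _]zE ler_wpM2l.
Qed.

(** The sum [g] of the squared moduli is used since the modulus is not differentiable at 0. It
    satisfies [g' <= K g] with [K = 2 c M], so [g exp(- K t)], which is 0 at 0, is at most 0 at 1 by
    the mean value theorem. *)
Lemma gronwall_zero (M : nat) (w w' : 'I_M -> R -> C) (c : R) : 0 <= c ->
  (forall k t, 0 <= t <= 1 ->
     (s%:C)^-1 * (w k (s + t) - w k t) @[s --> (0 : R)^'] --> w' k t) ->
  (forall k t, 0 <= t <= 1 -> `|w' k t| <= c%:C * \sum_l `|w l t|) ->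
  (forall k, w k 0 = 0) -> forall k, w k 1 = 0.
Proof.
move=> c0 dw w'le w0.
pose gk k : R -> R :=
  (complex.Re (R:=R) \o w k) ^+ 2 + (complex.Im (R:=R) \o w k) ^+ 2.
pose dgk k (t : R) : R := 2 * complex.Re (w k t) * complex.Re (w' k t) +
                          2 * complex.Im (w k t) * complex.Im (w' k t).
pose g := \sum_k gk k; pose dg t := \sum_k dgk k t.
have gE t : g t = \sum_k normsq (w k t).
  by rewrite /g fct_sumE; apply: eq_bigr => k _.
have gd (t : R) : 0 <= t <= 1 -> is_derive t (1 : R) g (dg t).
  move=> t01.
  suff H k : is_derive t (1 : R) (gk k) (dgk k t) by exact: is_derive_sum.
  have dRe : is_derive t (1 : R) (complex.Re (R:=R) \o w k) (complex.Re (w' k t)).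
    apply: is_derive_ReIm (dw k t t01) => [[? ?] [? ?]//|x z|z].
      exact: Re_realM.
    exact: normc_ge_Re.
  have dIm : is_derive t (1 : R) (complex.Im (R:=R) \o w k) (complex.Im (w' k t)).
    apply: is_derive_ReIm (dw k t t01) => [[? ?] [? ?]//|x z|z].
      exact: Im_realM.
    exact: normc_ge_Im.
  apply: is_derive_eq (is_deriveD (is_deriveX 2 dRe) (is_deriveX 2 dIm)) _.
  by rewrite /= !expr1.
pose K := 2 * c * M%:R.
have dgle (t : R) : 0 <= t <= 1 -> dg t <= K * g t.
  move=> t01; pose N k := complex.Re `|w k t|.
  have NE k : (N k)%:C = `|w k t| by rewrite RRe_real ?normr_real.
  have N2 k : N k ^+ 2 = normsq (w k t).
    by apply: complexI; rewrite rmorphXn /= NE normsqE.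
  have w'N k : `|w' k t| <= (c * \sum_l N l)%:C.
    rewrite rmorphM rmorph_sum /=; apply: le_trans (w'le _ _ t01) _.
    by under [X in _ <= _ * X]eq_bigr do rewrite NE.
  (* Each product [2 N_k N_l] is bounded by [N_k^2 + N_l^2]; summing over all pairs gives the factor
     [2 M] in [K]. *)
  apply: (@le_trans _ _ (\sum_k \sum_l c * (N k ^+ 2 + N l ^+ 2))).
    apply: ler_sum => k _; rewrite /dgk -!mulrA -mulrDr.
    apply: (@le_trans _ _ (2 * (N k * (c * \sum_l N l)))).
      by apply: ler_wpM2l => //; exact: normsq_dot.
    have -> : 2 * (N k * (c * \sum_l N l)) = \sum_l c * (2 * (N k * N l)).
      by rewrite -!mulr_sumr; ring.
    apply: ler_sum => l _; apply: ler_wpM2l => //; rewrite -subr_ge0.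
    by rewrite (_ : _ - _ = (N k - N l) ^+ 2) ?sqr_ge0 //; ring.
  rewrite le_eqVlt; apply/orP; left; apply/eqP.
  have S : \sum_l N l ^+ 2 = g t by rewrite gE; apply: eq_bigr.
  rewrite (eq_bigr (fun k => c * (M%:R * N k ^+ 2 + g t))) => [|k _].
    rewrite -mulr_sumr big_split /= -mulr_sumr S sumr_const card_ord.
    by rewrite -mulr_natl /K; ring.
  by rewrite -mulr_sumr big_split /= S sumr_const card_ord mulr_natl.
pose h := g * (expR \o (fun t : R => - K * t)).
have hd (t : R) : 0 <= t <= 1 -> is_derive t (1 : R) h ((dg t - K * g t) * expR (- K * t)).
  move=> /gd gt.
  have lt : is_derive t (1 : R) (fun t : R => - K * t) (- K).
    have := @is_deriveZ _ _ _ id (- K) t 1 1 (is_derive_id _ _).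
    by rewrite /GRing.scale /= mulr1.
  have et := is_derive1_comp (is_derive_expR (- K * t)) lt.
  apply: is_derive_eq (is_deriveM gt et) _.
  by rewrite /GRing.scale /=; ring.
have hc : {within `[0, 1], continuous h}.
  apply: continuous_in_subspaceT => t; rewrite inE /= in_itv /= => t01.
  have [ht _] := hd t t01.
  exact/differentiable_continuous/derivable1_diffP.
have [x x01] : exists2 x : R, x \in `]0, 1[%R & h 1 - h 0 =
    (dg x - K * g x) * expR (- K * x) * (1 - 0).
  apply: (MVT ltr01 _ hc) => x; rewrite in_itv /= => /andP[x0 x1].
  by apply: hd; rewrite !ltW.
have x01' : 0 <= x <= 1 by move: x01; rewrite in_itv /= => /andP[/ltW-> /ltW->].
have h0 : h 0 = 0.
  rewrite /h /GRing.mul /= gE big1 ?mul0r // => k _.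
  by rewrite w0 /normsq /= expr0n addr0.
rewrite h0 !subr0 mulr1 => h1.
have : g 1 <= 0.
  have : h 1 <= 0 by rewrite h1 mulr_le0_ge0 ?expR_ge0 // subr_le0 dgle.
  by rewrite /h /GRing.mul /= pmulr_lle0 // expR_gt0.
rewrite gE => g1 k; apply/eqP; rewrite -normr_eq0 -sqrf_eq0 normsqE.
rewrite (_ : 0 = 0%:C) // eq_complex /= eqxx andbT.
have n0 (i : 'I_M) : 0 <= normsq (w i 1) by rewrite addr_ge0 ?sqr_ge0.
have /eqP : \sum_k normsq (w k 1) = 0.
  by apply/eqP; rewrite eq_le g1 sumr_ge0.
by rewrite psumr_eq0 // => /allP/(_ k); rewrite mem_index_enum => /(_ isT).
Qed.
End Gronwall.

(** * The Lie algebra of G *)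

(** A free family in [S] is extended by a vector of [S] outside its span as long as there is one;
    this stops since ranks are at most [N]. It turns a subspace given by a mere predicate into a
    matrix. *)
Lemma subspace_basis (F : fieldType) N (S : 'rV[F]_N -> Prop) :
  S 0 -> (forall a u v, S u -> S v -> S (a *: u + v)) ->
  exists d (B : 'M[F]_(d, N)), row_free B /\ forall v, S v <-> (v <= B)%MS.
Proof.
move=> S0 SD.
have SB d (B : 'M[F]_(d, N)) v : (forall i, S (row i B)) -> (v <= B)%MS -> S v.
  move=> SB /submxP[a ->]; rewrite mulmx_sum_row.
  elim/big_rec: _ => // i u _ Su; exact: SD.
suff H k d (B : 'M[F]_(d, N)) : (N - d <= k)%N -> row_free B ->
    (forall i, S (row i B)) ->
    exists d (B : 'M[F]_(d, N)), row_free B /\ forall v, S v <-> (v <= B)%MS.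
  by apply: (H N 0%N 0) => [||[]] //; [rewrite subn0|rewrite /row_free mxrank0].
elim: k d B => [|k IH] d B dk fB SrB.
  exists d, B; split=> // v; split=> [_|]; last exact: SB.
  apply: submx_full; rewrite /row_full eqn_leq rank_leq_col /= (eqP fB).
  by rewrite -subn_eq0 -leqn0.
have [[v Sv vB]|H] := pselect (exists2 v, S v & ~~ (v <= B)%MS); last first.
  exists d, B; split=> // v; split=> [Sv|]; last exact: SB.
  by apply: contrapT => /negP vB; apply: H; exists v.
have rB : row_free (col_mx v B).
  rewrite /row_free eqn_leq rank_leq_row /=.
  suff : (d < \rank (col_mx v B))%N by [].
  rewrite -[X in (X < _)%N](eqP fB).
  have : (B < col_mx v B)%MS.
    rewrite /ltmx -!addsmxE addsmxSr /=; apply: contra vB.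
    by rewrite addsmx_sub => /andP[].
  by rewrite ltmxErank => /andP[].
apply: (IH _ (col_mx v B)) => // [|i].
  by rewrite add1n subnS -ltnS; case: (N - d)%N dk.
case: (split_ordP i) => j ->; last by rewrite rowKd.
by rewrite rowKu row_id.
Qed.

Section LieAlgebraOfG.
Variables (R : realType) (n : nat).
Local Notation C := R[i].
Variable G : set 'M[C]_n.
Hypothesis GG : subgroup_GL G.
Local Notation N := (n * n)%N.
Local Notation g := (Lie_algebra G).

Definition vanishes (p : mpoly N C) : Prop := forall a, G a -> peval p (mxvec a) = 0.

Lemma Lie_algebraP X :
  g X <-> forall p, vanishes p -> mxvec X *m pgrad p (mxvec 1%:M) = 0.
Proof.
have E p : (mxvec X *m pgrad p (mxvec 1%:M)) ord0 ord0 =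
    \sum_(k < N) mxeval (mderiv k p) 1%:M * mxvec X ord0 k.
  by rewrite mxE; apply: eq_bigr => k _; rewrite mxE mulrC.
split=> [gX p Ip|gX p Ip].
  by apply/rowP => j; rewrite ord1 E [RHS]mxE; apply: gX.
by rewrite -E gX // mxE.
Qed.

Lemma Lie_algebra_lin a X Y : g X -> g Y -> g (a *: X + Y).
Proof.
move=> /Lie_algebraP gX /Lie_algebraP gY; apply/Lie_algebraP => p Ip.
by rewrite linearP mulmxDl -scalemxAl gX // gY // scaler0 addr0.
Qed.

Lemma Lie_algebra0 : g 0.
Proof. by apply/Lie_algebraP => p _; rewrite linear0 mul0mx. Qed.

(** Composing [p] with left multiplication by [a] gives another polynomial vanishing on [G], whose
    differential at 1 is that of [p] at [a] after translation. *)
Lemma Lie_algebra_translate p X a : vanishes p -> g X -> G a ->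
  mxvec (a *m X) *m pgrad p (mxvec a) = 0.
Proof.
move=> Ip /Lie_algebraP gX Ga; have [q qE] := peval_linear_comp p (lin_mulmx a).
have Iq : vanishes q.
  by move=> b Gb; rewrite qE mul_vec_lin Ip //=; case: GG => _ _ GM _; apply: GM.
have := gX q Iq; rewrite (pgrad_linear_comp qE) !mulmxA !mul_vec_lin /=.
by rewrite mulmx1.
Qed.

Lemma Lie_algebra_Ad a X : G a -> g X -> g (Ad a X).
Proof.
case: GG => Gu _ GM GV Ga /Lie_algebraP gX; apply/Lie_algebraP => p Ip.
have [q qE] := peval_linear_comp p (lin_mulmx a *m lin_mulmxr (invmx a)).
have Iq : vanishes q.
  move=> b Gb; rewrite qE mulmxA !mul_vec_lin Ip //=.
  by apply: (GM); [exact: (GM)|exact: GV].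
have := gX q Iq; rewrite (pgrad_linear_comp qE) !mulmxA !mul_vec_lin /=.
by rewrite mulmx1 mulmxV // Gu.
Qed.

(** The derivative of [p] along the left-invariant field [a |-> a *m X]; the inner sum is the [k]-th
    coordinate of [a *m X], a linear form in [a]. *)
Definition left_derivation (X : 'M[C]_n) (p : mpoly N C) : mpoly N C :=
  \sum_k mderiv k p *
     \sum_l (lin_mulmxr X : 'M[C]_N) l k *: mpolyX C (mnm1 l).

Lemma left_derivationE X p a :
  peval (left_derivation X p) (mxvec a) = (mxvec (a *m X) *m pgrad p (mxvec a)) ord0 ord0.
Proof.
rewrite /peval raddf_sum mxE; apply: eq_bigr => k _ /=.
rewrite mevalM [in RHS]mxE mulrC; congr (_ * _).
rewrite -(mul_vec_lin (mulmxr X)) mxE raddf_sum; apply: eq_bigr => l _ /=.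
by rewrite mevalZ mevalXU mulrC.
Qed.

Lemma left_derivation_vanishes X p : g X -> vanishes p -> vanishes (left_derivation X p).
Proof. by move=> gX Ip a Ga; rewrite left_derivationE Lie_algebra_translate // mxE. Qed.

(** Differentiating a second time yields the Hessian at [(Y, X)] and a first-order term in [Y *m X].
    The Hessian being symmetric, exchanging [X] and [Y] and subtracting leaves the bracket. *)
Lemma left_derivation_grad X Y p :
  (mxvec Y *m pgrad (left_derivation X p) (mxvec 1%:M)) ord0 ord0 =
  \sum_j \sum_k mxvec Y ord0 j * mxvec X ord0 k *
      peval (mderiv j (mderiv k p)) (mxvec 1%:M) +
  (mxvec (Y *m X) *m pgrad p (mxvec 1%:M)) ord0 ord0.
Proof.
set T := (lin_mulmxr X : 'M[C]_N).
have XE k : mxvec X ord0 k = (mxvec 1%:M *m T) ord0 k.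
  by rewrite /T mul_vec_lin /= mul1mx.
have dE j : peval (mderiv j (left_derivation X p)) (mxvec 1%:M) =
    \sum_k (mxvec X ord0 k * peval (mderiv j (mderiv k p)) (mxvec 1%:M) +
            T j k * peval (mderiv k p) (mxvec 1%:M)).
  rewrite /peval [mderiv j _]raddf_sum raddf_sum; apply: eq_bigr => k _ /=.
  rewrite mderivM mevalD !mevalM mulrC XE; congr (_ * _ + _).
    rewrite mxE raddf_sum; apply: eq_bigr => l _ /=.
    by rewrite mevalZ mevalXU mulrC.
  rewrite mulrC; congr (_ * _).
  rewrite (raddf_sum (mderiv j)) raddf_sum (bigD1 j) //= mderivZ mderivX mnm1E eqxx.
  rewrite scale1r -{1}[mnm1 j]add0m addmK mpolyX0 mevalZ meval1 mulr1.
  rewrite big1 ?addr0 // => l lj; rewrite mderivZ mderivX mnm1E (negbTE lj).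
  by rewrite scale0r scaler0 meval0.
rewrite -(mul_vec_lin (mulmxr X)) -/T -mulmxA [in RHS]mxE [in LHS]mxE -big_split /=.
apply: eq_bigr => j _; rewrite !mxE dE big_split /= mulrDr !mulr_sumr.
congr (_ + _); apply: eq_bigr => k _; rewrite ?mxE; ring.
Qed.

Lemma Lie_algebra_lie X Y : g X -> g Y -> g (lie X Y).
Proof.
move=> gX gY; apply/Lie_algebraP => p Ip; apply/rowP => j; rewrite ord1 [RHS]mxE.
have H1 : (mxvec Y *m pgrad (left_derivation X p) (mxvec 1%:M)) ord0 ord0 = 0.
  by have /Lie_algebraP -> := gY; [rewrite mxE|exact: left_derivation_vanishes].
have H2 : (mxvec X *m pgrad (left_derivation Y p) (mxvec 1%:M)) ord0 ord0 = 0.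
  by have /Lie_algebraP -> := gX; [rewrite mxE|exact: left_derivation_vanishes].
rewrite left_derivation_grad in H1; rewrite left_derivation_grad in H2.
set S1 := \sum_j _ in H1; set S2 := \sum_j _ in H2.
have SE : S1 = S2.
  rewrite /S1 exchange_big /=; apply: eq_bigr => i _; apply: eq_bigr => k _.
  by rewrite mderiv_comm [X in X * _]mulrC.
rewrite /lie linearB mulmxBl mxE [X in _ + X]mxE.
apply/eqP; rewrite subr_eq0; apply/eqP/(addrI S1).
by rewrite H1 SE H2.
Qed.

Lemma msize_mderiv k (p : mpoly N C) : (msize (mderiv k p) <= (msize p).-1)%N.
Proof.
apply: leq_trans (msize_sum _ _ _) _; apply/bigmax_leqP_seq => m mp _.
have mlt := msize_mdeg_lt mp.
have [m0|m0] := eqVneq (m k) 0%N; first by rewrite m0 mul0r scale0r msize0.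
apply: leq_trans (msizeZ_le _ _) _; rewrite msizeX.
have mE : m = mnm_add (mnm_sub m (mnm1 k)) (mnm1 k).
  by rewrite submK //; apply/mnm_lepP => l; rewrite mnm1E; case: eqP => // <-; rewrite lt0n.
by move: mlt; rewrite {1}mE mdegD mdeg1 addn1; case: (msize p).
Qed.

(** Differentiation lowers the degree by one and the linear factor restores it. Hence the
    polynomials of bounded degree vanishing on [G] form a finite-dimensional space stable under
    these derivations, and Gronwall applies to a finite system. *)
Lemma left_derivation_msize X p : (msize (left_derivation X p) <= msize p)%N.
Proof.
apply: leq_trans (msize_sum _ _ _) _; apply/bigmax_leqP_seq => k _ _.
set l := \sum_l _.
have l2 : (msize l <= 2)%N.
  apply: leq_trans (msize_sum _ _ _) _; apply/bigmax_leqP_seq => i _ _.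
  by apply: leq_trans (msizeZ_le _ _) _; rewrite msizeX mdeg1.
have [->|p0] := eqVneq (mderiv k p) 0; first by rewrite mul0r msize0.
have [->|l0] := eqVneq l 0; first by rewrite mulr0 msize0.
rewrite msizeM //; have := msize_mderiv k p.
have : (0 < msize (mderiv k p))%N by rewrite lt0n msize_poly_eq0.
by move: (msize p) (msize (mderiv k p)) (msize l) l2 => *; lia.
Qed.

(** Polynomials of size at most [b] are identified with the rows of their coefficients, indexed by
    the finite type of monomials, and [subspace_basis] is applied there. *)
Lemma vanishing_span b : exists M (q : 'I_M -> mpoly N C),
  (forall k, vanishes (q k) /\ (msize (q k) <= b)%N) /\
  forall p, vanishes p -> (msize p <= b)%N ->
    exists a : 'I_M -> C, forall z, peval p z = \sum_k a k * peval (q k) z.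
Proof.
pose T : finType := bmultinom N b.
pose P (v : 'rV[C]_#|T|) : mpoly N C :=
  \sum_i v ord0 i *: mpolyX C (bmnm (enum_val i : bmultinom N b)).
have PL a u v : P (a *: u + v) = a *: P u + P v.
  rewrite /P scaler_sumr -big_split; apply: eq_bigr => i _ /=.
  by rewrite !mxE scalerDl scalerA.
have pevalL a p q z : peval (a *: p + q) z = a * peval p z + peval q z.
  by rewrite /peval mevalD mevalZ.
have [||d [B [_ BE]]] := @subspace_basis C _ (fun v => vanishes (P v)).
- move=> a _; rewrite /P big1 /peval ?meval0 // => i _.
  by rewrite mxE scale0r.
- by move=> a u v Iu Iv z Gz; rewrite PL pevalL Iu // Iv // mulr0 addr0.
exists d, (fun k => P (row k B)); split=> [k|p Ip pb].
  split; first by apply/BE; exact: row_sub.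
  apply: leq_trans (msize_sum _ _ _) _; apply/bigmax_leqP_seq => i _ _.
  apply: leq_trans (msizeZ_le _ _) _; rewrite msizeX; exact: bmdeg.
pose v : 'rV[C]_#|T| := \row_i mcoeff (bmnm (enum_val i : bmultinom N b)) p.
have vE : P v = p.
  rewrite [RHS](mpolywE (k := b)) // /P (reindex (enum_rank : T -> _)) /=; last first.
    by exists enum_val => ? _; [exact: enum_rankK|exact: enum_valK].
  by apply: eq_bigr => m _; rewrite mxE enum_rankK.
have /submxP[a vaB] : (v <= B)%MS by apply/BE; rewrite vE.
exists (a ord0) => z; rewrite -vE vaB mulmx_sum_row.
elim/big_rec2: _ => [|k u w _ <-]; last by rewrite PL pevalL.
rewrite /P /peval big1 ?meval0 // => i _; by rewrite mxE scale0r.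
Qed.

End LieAlgebraOfG.

(** * Continuity of matrix-valued maps *)

Section MatrixContinuity.
Variable R : realType.
Local Notation C := R[i].

Lemma cvg_mx (T : Type) (F : set_system T) (FF : Filter F) m k
    (A : T -> 'M[C]_(m, k)) (a : 'M[C]_(m, k)) :
  (forall i j, A z i j @[z --> F] --> a i j) -> A z @[z --> F] --> a.
Proof.
move=> Ac; apply/cvgrPdist_le => e e0.
have : \forall z \near F, forall ij : 'I_m * 'I_k, `|a ij.1 ij.2 - A z ij.1 ij.2| <= e.
  by apply: filter_forall => -[i j] /=; have /cvgrPdist_le := Ac i j; apply.
apply: filterS => z H; apply: mx_norm_leP => [|i j]; first exact: ltW.
by rewrite !mxE; exact: (H (i, j)).
Qed.

Lemma matrix_continuous (T : topologicalType) m k (A : T -> 'M[C]_(m, k)) (x : T) :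
  (forall i j, {for x, continuous (fun z => A z i j)}) -> {for x, continuous A}.
Proof. by move=> Ac; apply: cvg_mx => i j; exact: Ac. Qed.

Lemma cvg_mulmx (T : Type) (F : set_system T) (FF : Filter F) m k l
    (A : T -> 'M[C]_(m, k)) (B : T -> 'M[C]_(k, l)) (a : 'M[C]_(m, k)) (b : 'M[C]_(k, l)) :
  A z @[z --> F] --> a -> B z @[z --> F] --> b ->
  A z *m B z @[z --> F] --> a *m b.
Proof.
move=> Ac Bc; apply: cvg_mx => i j.
have E : (fun z => (A z *m B z) i j) = (fun z => \sum_r A z i r * B z r j).
  by apply/funext => z; rewrite mxE.
rewrite E mxE; apply: cvg_big => [|r _]; first exact: add_continuous.
apply: cvgM.
  exact: cvg_comp Ac (@coord_continuous _ _ _ i r _).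
exact: cvg_comp Bc (@coord_continuous _ _ _ r j _).
Qed.

Lemma linear_rV_continuous N (V : normedModType C) (f : {linear 'rV[C]_N -> V}) :
  continuous f.
Proof.
apply: (@linear_bound_continuous _ _ _ _ (\sum_i `|f (delta_mx ord0 i)|)) => [|v].
  by rewrite sumr_ge0.
rewrite {1}[v]row_sum_delta linear_sum mulr_suml; apply: le_trans (ler_norm_sum _ _ _) _.
apply: ler_sum => i _; rewrite linearZ normrZ mulrC ler_wpM2l //.
exact: mx_norm_entry.
Qed.

Lemma difference_kernel_of_cvg N N' (f : 'rV[C]_N -> 'rV[C]_N') K :
  (forall a b, f a - f b = (a - b) *m K a b) ->
  (forall a, K z.1 z.2 @[z --> (a, a)] --> K a a) -> difference_kernel f K.
Proof.
move=> fK Kc; split=> // a e e0.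
have : \forall z \near (a, a), `|K a a - K z.1 z.2| < e.
  by have /cvgrPdist_lt := Kc a; apply.
move=> /nbhs_ballP[d d0 Hd]; exists d => // b c ba ca.
rewrite distrC; have := Hd (b, c); apply.
by split; rewrite /= -ball_normE /= distrC.
Qed.

Lemma kernel_family N N' (F : 'I_N' -> 'rV[C]_N -> C) (dF : 'I_N' -> 'rV[C]_N -> 'cV[C]_N) :
  (forall j, has_kernel (F j) (dF j)) ->
  exists K, difference_kernel (fun a => \row_j F j a) K /\
    forall a, K a a = \matrix_(i, j) dF j a i ord0.
Proof.
move=> H; have /choice[k kP] : forall j, exists k : 'rV[C]_N -> 'rV[C]_N -> 'cV[C]_N,
    [/\ forall a b, F j a - F j b = ((a - b) *m k a b) ord0 ord0,
        forall a, k a a = dF j a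
      & forall a, k z.1 z.2 @[z --> (a, a)] --> dF j a].
  by move=> j; have [_ [k kP]] := H j; exists k.
exists (fun a b => \matrix_(i, j) k j a b i ord0); split; last first.
  by move=> a; apply/matrixP => i j; rewrite !mxE; have [_ ->] := kP j.
apply: difference_kernel_of_cvg => [a b|a].
  apply/rowP => j; have [E _ _] := kP j.
  by rewrite !mxE E mxE; apply: eq_bigr => i _; rewrite !mxE.
apply: cvg_mx => i j; have [_ kd kc] := kP j.
have -> : (fun z : 'rV[C]_N * 'rV[C]_N => (\matrix_(i, j) k j z.1 z.2 i ord0) i j) =
    (fun M : 'cV[C]_N => M i ord0) \o (fun z => k j z.1 z.2).
  by apply/funext => z; rewrite mxE.
rewrite mxE kd.
exact: cvg_comp (kc a) (@coord_continuous _ _ _ i ord0 _).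
Qed.

Lemma peval_bounded N (p : mpoly N C) (r : C) :
  exists2 c, 0 <= c & forall a, `|a| <= r -> `|peval p a| <= c.
Proof.
elim/mpoly_ring_ind: p => [c|i|p q [c c0 cP] [d d0 dQ]|p q [c c0 cP] [d d0 dQ]].
- by exists `|c| => // a _; rewrite /peval mevalC.
- exists `|r| => // a ar; rewrite /peval mevalXU.
  apply: le_trans (mx_norm_entry _ _ _) _; apply: le_trans (ar) _.
  by rewrite ger0_norm // (le_trans _ ar).
- exists (c + d) => [|a ar]; first exact: addr_ge0.
  by rewrite /peval mevalD; apply: le_trans (ler_normD _ _) _; rewrite lerD // ?cP ?dQ.
- exists (c * d) => [|a ar]; first exact: mulr_ge0.
  by rewrite /peval mevalM normrM ler_pM // ?cP ?dQ.
Qed.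

(** The perturbation estimate behind [inverse_function], with one constant valid on a whole
    neighbourhood; such uniform constants make the Gronwall bound independent of time. *)
Lemma near_left_injective (T : topologicalType) N N' (A : T -> 'M[C]_(N, N'))
    (x : T) (J : 'M[C]_(N', N)) :
  {for x, continuous A} -> A x *m J = 1%:M ->
  exists2 c : C, 0 <= c & \forall z \near x, forall v : 'rV[C]_N, `|v| <= c * `|v *m A z|.
Proof.
move=> Ac AJ; exists (2 * (N'%:R * `|J|)); first by rewrite !mulr_ge0.
pose X : C := N%:R * (N'%:R * `|J|); have X0 : 0 <= X by rewrite !mulr_ge0.
pose d1 : C := (2 * (X + 1))^-1.
have d10 : 0 < d1 by rewrite invr_gt0 mulr_gt0 // ltr_wpDl.
have : \forall z \near x, `|A x - A z| < d1 by move/cvgrPdist_lt: Ac; apply.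
apply: filterS => z Az v.
have H1 : `|v - v *m A z *m J| <= `|v| / 2.
  rewrite -{1}[v]mulmx1 -AJ -mulmxA -mulmxBr -mulmxBl.
  apply: le_trans (mulmx_norm _ _) _; rewrite mulrCA ler_wpM2l //.
  apply: (@le_trans _ _ (N%:R * (N'%:R * (d1 * `|J|)))).
    rewrite ler_wpM2l //; apply: le_trans (mulmx_norm _ _) _.
    by rewrite ler_wpM2l // ler_wpM2r // ltW.
  have -> : N%:R * (N'%:R * (d1 * `|J|)) = X / (2 * (X + 1)).
    by rewrite /d1; move: (_^-1) => i; rewrite /X; ring.
  rewrite ler_pdivrMr ?mulr_gt0 ?ltr_wpDl // mulrA mulVf ?pnatr_eq0 // mul1r.
  by rewrite lerDl.
have H2 : `|v| <= `|v| / 2 + N'%:R * `|J| * `|v *m A z|.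
  rewrite -{1}(subrK (v *m A z *m J) v).
  apply: le_trans (ler_normD _ _) _; apply: lerD => //.
  apply: le_trans (mulmx_norm _ _) _.
  by rewrite mulrCA mulrC.
move: H2; rewrite -lerBlDl (_ : _ - _ / 2 = `|v| / 2); last by field.
by rewrite ler_pdivrMr // mulrC !mulrA.
Qed.

Lemma square_inverse N N' (A : 'M[C]_(N, N')) : N = N' ->
  (forall v : 'rV_N, v *m A = 0 -> v = 0) ->
  exists J, A *m J = 1%:M /\ J *m A = 1%:M.
Proof.
move=> NN' Ai; have fA := inj_row_free Ai.
exists (pinvmx A); rewrite mulmxVp // mulVpmx //.
by rewrite /row_full (eqP fA) NN'.
Qed.

Lemma row_mx_continuous (T : topologicalType) m k1 k2 (A : T -> 'M[C]_(m, k1))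
    (B : T -> 'M[C]_(m, k2)) (x : T) :
  {for x, continuous A} -> {for x, continuous B} ->
  {for x, continuous (fun z => row_mx (A z) (B z))}.
Proof.
move=> Ac Bc; apply: matrix_continuous => i j.
case: (split_ordP j) => k ->.
  rewrite (_ : (fun z => row_mx _ _ _ _) = (fun M : 'M[C]_(m, k1) => M i k) \o A).
    exact: continuous_comp Ac (@coord_continuous _ _ _ i k _).
  by apply/funext => z; rewrite row_mxEl.
rewrite (_ : (fun z => row_mx _ _ _ _) = (fun M : 'M[C]_(m, k2) => M i k) \o B).
  exact: continuous_comp Bc (@coord_continuous _ _ _ i k _).
by apply/funext => z; rewrite row_mxEr.
Qed.

Lemma difference_kernel_row_mx N N1 N2 (f1 : 'rV[C]_N -> 'rV[C]_N1)
    (f2 : 'rV[C]_N -> 'rV[C]_N2) K1 K2 :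
  difference_kernel f1 K1 -> difference_kernel f2 K2 ->
  difference_kernel (fun a => row_mx (f1 a) (f2 a)) (fun a b => row_mx (K1 a b) (K2 a b)).
Proof.
move=> [E1 c1] [E2 c2]; split=> [a b|a e e0].
  by rewrite mul_mx_row -E1 -E2 opp_row_mx add_row_mx.
have e2 : 0 < e / 2 by rewrite divr_gt0.
have [d1 d10 H1] := c1 a _ e2; have [d2 d20 H2] := c2 a _ e2.
have [d [d0 dd1 dd2]] := exists_min d10 d20; exists d => // b c ba ca.
apply: (@le_lt_trans _ _ (e / 2)); last by rewrite ltr_pdivrMr // ltr_pMr // ltr1n.
apply: mx_norm_leP => [|i j]; first exact: ltW.
rewrite opp_row_mx add_row_mx mxE; case: (fintype.split j) => k.
  apply: le_trans (mx_norm_entry _ _ _) _; apply/ltW/H1.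
    exact: lt_le_trans ba dd1.
  exact: lt_le_trans ca dd1.
apply: le_trans (mx_norm_entry _ _ _) _; apply/ltW/H2.
  exact: lt_le_trans ba dd2.
exact: lt_le_trans ca dd2.
Qed.

Lemma difference_kernel_affine N N' (a0 : 'rV[C]_N) (T : 'M[C]_(N, N')) :
  difference_kernel (fun a => (a - a0) *m T) (fun _ _ => T).
Proof.
split=> [a b|a e e0]; first by rewrite -mulmxBl opprB addrA subrK.
by exists 1 => // b c _ _; rewrite subrr normr0.
Qed.

Lemma difference_kernel_is_diff N N' (f : 'rV[C]_N -> 'rV[C]_N') K a :
  difference_kernel f K -> is_diff a f (mulmxr (K a a)).
Proof.
move=> [fK Kc]; apply: is_diff_littleo; first exact: continuous_mulmxr.
move=> e e0; have d0 : 0 < N%:R + 1 :> C by rewrite ltr_wpDl.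
have [d dd0 Kd] := Kc a (e / (N%:R + 1)) (divr_gt0 e0 d0).
exists d => // h hd; rewrite fK addrK /= -mulmxBr.
apply: le_trans (mulmx_norm _ _) _; rewrite mulrCA mulrC ler_wpM2r //.
have Kh : `|K (h + a) a - K a a| < e / (N%:R + 1).
  by apply: Kd; rewrite ?addrK // subrr normr0.
apply: (@le_trans _ _ (N%:R * (e / (N%:R + 1)))); first by rewrite ler_wpM2l // ltW.
by rewrite mulrCA ler_piMr // ?ltW // ltr_pdivrMr // mul1r ltrDl.
Qed.

Lemma near_norm_bound (T : topologicalType) (V : normedModType C) (A : T -> V) (x : T) :
  {for x, continuous A} -> \forall z \near x, `|A z| <= `|A x| + 1.
Proof.
move=> /cvgrPdist_lt/(_ 1 ltr01); apply: filterS => z Az.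
rewrite -[A z](subrK (A x)) addrC; apply: le_trans (ler_normD _ _) _.
by rewrite lerD2l distrC ltW.
Qed.

End MatrixContinuity.

(** * Local equations of G *)

Section LocalEquations.
Variables (R : realType) (n : nat).
Local Notation C := R[i].
Variable G : set 'M[C]_n.
Hypothesis GG : subgroup_GL G.
Local Notation N := (n * n)%N.
Local Notation g := (Lie_algebra G).

Definition pjacobian M c (p : 'I_c -> mpoly M C) (a : 'rV[C]_M) : 'M[C]_(M, c) :=
  \matrix_(k, i) pgrad (p i) a k ord0.

Lemma mul_pjacobian M c (p : 'I_c -> mpoly M C) a (v : 'rV[C]_M) i :
  (v *m pjacobian p a) ord0 i = (v *m pgrad (p i) a) ord0 ord0.
Proof. by rewrite !mxE; apply: eq_bigr => k _; rewrite !mxE. Qed.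

Lemma pjacobian_continuous M c (p : 'I_c -> mpoly M C) : continuous (pjacobian p).
Proof.
move=> a; apply: matrix_continuous => k i.
have [pc _] := peval_has_kernel (mderiv k (p i)).
have -> : (fun z => pjacobian p z k i) = peval (mderiv k (p i)).
  by apply/funext => z; rewrite !mxE.
exact: pc.
Qed.

(** The gradients at 1 of the polynomials vanishing on [G] form a subspace; the [p_i] have gradients
    forming a basis of it. Independence is what gives [d + c = N]. *)
Lemma local_equations : exists c (p : 'I_c -> mpoly N C) d (B : 'M[C]_(d, N)),
  [/\ forall i, vanishes G (p i), row_free B, (d + c = N)%N,
      forall X, g X <-> (mxvec X <= B)%MS
    & forall v : 'rV[C]_N, v *m pjacobian p (mxvec 1%:M) = 0 <-> (v <= B)%MS].
Proof.
have pevalL a p q z : peval (a *: p + q) z = a * peval p z + peval q z :> C.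
  by rewrite /peval mevalD mevalZ.
pose S (v : 'rV[C]_N) := exists2 p, vanishes G p & v = (pgrad p (mxvec 1%:M))^T.
have [||c [A [fA AE]]] := @subspace_basis C N S.
- exists 0; first by move=> a _; rewrite /peval meval0.
  by apply/rowP => k; rewrite !mxE mderiv0 /peval meval0.
- move=> a u v [p Ip ->] [q Iq ->]; exists (a *: p + q).
    by move=> b Gb; rewrite pevalL Ip // Iq // mulr0 addr0.
  apply/rowP => k; rewrite [RHS]mxE pgradE mderivD mderivZ pevalL.
  have tE s : (pgrad s (mxvec 1%:M))^T ord0 k = peval (mderiv k s) (mxvec 1%:M) :> C.
    by rewrite mxE pgradE.
  by rewrite mxE [X in X + _]mxE !tE.
have /choice[p pE] : forall i, exists p, vanishes G p /\ row i A = (pgrad p (mxvec 1%:M))^T.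
  by move=> i; have /AE[p Ip E] := row_sub i A; exists p.
have LE : pjacobian p (mxvec 1%:M) = A^T.
  apply/matrixP => k i; rewrite [RHS]mxE.
  have /rowP/(_ k) := (pE i).2; rewrite [in X in X -> _]mxE => ->.
  by rewrite !mxE.
exists c, p, (\rank (kermx A^T)), (row_base (kermx A^T)); split.
- by move=> i; have [] := pE i.
- exact: row_base_free.
- by rewrite mxrank_ker mxrank_tr (eqP fA) subnK // -(eqP fA) rank_leq_col.
- move=> X; rewrite eq_row_base; split=> [/Lie_algebraP gX|].
    apply/sub_kermxP; rewrite -LE; apply/rowP => i.
    by rewrite mul_pjacobian gX ?mxE //; have [] := pE i.
  move=> /sub_kermxP XA; apply/Lie_algebraP => q Iq.
  have /submxP[a aE] : ((pgrad q (mxvec 1%:M))^T <= A)%MS by apply/AE; exists q.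
  by rewrite -[pgrad q _]trmxK aE trmx_mul mulmxA XA mul0mx.
- by move=> v; rewrite LE eq_row_base; split=> /sub_kermxP.
Qed.

Definition ltrans (z : 'rV[C]_N) : 'M[C]_N := lin_mulmx (vec_mx z : 'M[C]_n).

Lemma mul_ltrans z X : mxvec X *m ltrans z = mxvec (vec_mx z *m X).
Proof. exact: mul_vec_lin. Qed.

Lemma ltrans_continuous : continuous ltrans.
Proof.
have lin : linear ltrans.
  move=> a u v; apply/row_matrixP => i.
  rewrite !rowE mulmxDr -scalemxAr.
  have E z : delta_mx ord0 i *m ltrans z = mxvec (vec_mx z *m vec_mx (delta_mx ord0 i)).
    by rewrite -mul_ltrans vec_mxK.
  have vL : vec_mx (a *: u + v) = a *: vec_mx u + vec_mx v :> 'M[C]_n by exact: linearP.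
  by rewrite (E (a *: u + v)) (E u) (E v) vL mulmxDl -scalemxAl; exact: linearP.
pose lM := GRing.isLinear.Build _ _ _ _ _ lin.
pose lL : {linear _ -> _} := HB.pack ltrans lM.
exact: (@linear_rV_continuous R N _ lL).
Qed.

Lemma ltrans1 : ltrans (mxvec 1%:M) = 1%:M.
Proof.
apply/row_matrixP => i; rewrite !rowE -[delta_mx _ _]vec_mxK mul_ltrans mxvecK.
by rewrite mul1mx mulmx1.
Qed.

(** The derivatives of [p] along the rows of [B] are combinations of the [q_k] as polynomial
    functions, so the estimate holds at every matrix [z], on [G] or not. *)
Lemma derivation_bound d (B : 'M[C]_(d, N)) :
  (forall X, g X <-> (mxvec X <= B)%MS) ->
  forall M (q : 'I_M -> mpoly N C) b,
  (forall p, vanishes G p -> (msize p <= b)%N ->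
    exists a : 'I_M -> C, forall z, peval p z = \sum_k a k * peval (q k) z) ->
  forall p, vanishes G p -> (msize p <= b)%N ->
  exists2 c, 0 <= c & forall z (x : 'rV[C]_d),
   `|(x *m B *m ltrans z *m pgrad p z) ord0 ord0| <= c * `|x| * \sum_l `|peval (q l) z|.
Proof.
move=> BE M q b qS p Ip pb.
have gB j : g (vec_mx (row j B)) by apply/BE; rewrite vec_mxK row_sub.
have /choice[a aE] : forall j, exists a : 'I_M -> C, forall z,
    peval (left_derivation (vec_mx (row j B)) p) z = \sum_k a k * peval (q k) z.
  move=> j; apply: qS; first exact: left_derivation_vanishes.
  exact: leq_trans (left_derivation_msize _ _) pb.
exists (\sum_j \sum_k `|a j k|) => [|z x].
  by rewrite sumr_ge0 // => j _; rewrite sumr_ge0.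
have -> : (x *m B *m ltrans z *m pgrad p z) ord0 ord0 =
    \sum_j x ord0 j * \sum_k a j k * peval (q k) z.
  rewrite -mulmxA (mulmx_sum_row x) mulmx_suml summxE; apply: eq_bigr => j _.
  rewrite -scalemxAl mxE -aE.
  have := left_derivationE (vec_mx (row j B)) p (vec_mx z); rewrite vec_mxK => ->.
  by rewrite mulmxA -mul_ltrans vec_mxK.
apply: le_trans (ler_norm_sum _ _ _) _; rewrite -mulrA mulr_suml ler_sum // => j _.
rewrite normrM mulrCA ler_pM //; first exact: mx_norm_entry.
apply: le_trans (ler_norm_sum _ _ _) _; rewrite mulr_suml ler_sum // => k _.
rewrite normrM ler_wpM2l // (bigD1 k) //= lerDl sumr_ge0 //.
Qed.

End LocalEquations.

(** * The zero locus of the local equations agrees with the group near the identity *)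

Section ZeroLocus.
Variables (R : realType) (n : nat).
Local Notation C := R[i].
Variable G : set 'M[C]_n.
Hypothesis GG : subgroup_GL G.
Local Notation N := (n * n)%N.
Local Notation g := (Lie_algebra G).
Variables (c d : nat) (p : 'I_c -> mpoly N C) (B : 'M[C]_(d, N)).
Hypothesis Ip : forall i, vanishes G (p i).
Hypothesis fB : row_free B.
Hypothesis dcN : (d + c = N)%N.
Hypothesis BE : forall X, g X <-> (mxvec X <= B)%MS.
Hypothesis LE : forall v : 'rV[C]_N, v *m pjacobian p (mxvec 1%:M) = 0 <-> (v <= B)%MS.
Local Notation one := (mxvec 1%:M : 'rV[C]_N).
Local Notation P := (pjacobian p).
Local Notation Bp := (pinvmx B).

Lemma cvg_real_dnbhs0 : s%:C @[s --> (0 : R)^'] --> (0 : C)^'.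
Proof.
move=> A /= /nbhs_ballP[_ /= /gt0_complex[e e0 ->]]; rewrite -ball_normE => eA.
apply/nbhs_ballP; exists e => //= s; rewrite -ball_normE /= => se s0.
apply: eA; last by rewrite eq_complex /= eqxx andbT.
by rewrite /= -rmorphB normc_real ltcR.
Qed.

(** Passes from the complex derivative to the real parameter in which the Gronwall argument runs. *)
Lemma is_diff_real_line M M' (h : 'rV[C]_M -> 'rV[C]_M') (w : 'rV[C]_M) (t : R)
    (l : 'rV[C]_M -> 'rV[C]_M') :
  is_diff (t%:C *: w) h l ->
  (s%:C)^-1 *: (h ((s + t)%:C *: w) - h (t%:C *: w)) @[s --> (0 : R)^'] --> l w.
Proof.
move=> [hd hl].
have hw : derivable h (t%:C *: w) w by exact: diff_derivable.
have H : u^-1 *: ((h \o shift (t%:C *: w)) (u *: w) - h (t%:C *: w))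
    @[u --> (0 : C)^'] --> l w by rewrite -hl -deriveE.
have {H} := cvg_comp _ _ cvg_real_dnbhs0 H.
by apply: cvg_trans; apply: near_eq_cvg; near=> s; rewrite /= rmorphD scalerDl.
Unshelve. all: by end_near. Qed.

Lemma has_kernel_curve M f df (z : R -> 'rV[C]_M) (t : R) (v : 'rV[C]_M) :
  has_kernel f df ->
  (s%:C)^-1 *: (z (s + t) - z t) @[s --> (0 : R)^'] --> v ->
  (s%:C)^-1 * (f (z (s + t)) - f (z t)) @[s --> (0 : R)^'] -->
    (v *m df (z t)) ord0 ord0.
Proof.
move=> [_ [k [fk _ kc]]] zv.
have zc : z (s + t) @[s --> (0 : R)^'] --> z t.
  have s0 : s%:C @[s --> (0 : R)^'] --> (0 : C).
    by apply: cvg_trans cvg_real_dnbhs0 _; exact: cvg_within.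
  have ztc : z t @[s --> (0 : R)^'] --> z t by apply: cvg_cst.
  have H : s%:C *: ((s%:C)^-1 *: (z (s + t) - z t)) + z t @[s --> (0 : R)^']
    --> 0 *: v + z t := cvgD (cvgZ s0 zv) ztc.
  pose u (s : R) : 'rV[C]_M := s%:C *: ((s%:C)^-1 *: (z (s + t) - z t)) + z t.
  have E : (fun s => z (s + t)) = u.
    apply/funext => s; rewrite /u; have [->|s0'] := eqVneq s 0.
      by rewrite !scale0r !add0r.
    rewrite scalerA mulfV ?scale1r ?subrK //.
    by rewrite eq_complex /= eqxx andbT.
  have F0 : 0 *: v + z t = z t by rewrite scale0r add0r.
  rewrite E.
  rewrite -F0.
  exact: H.
have ztc : z t @[s --> (0 : R)^'] --> z t by apply: cvg_cst.
have zzc : (z (s + t), z t) @[s --> (0 : R)^'] --> (z t, z t).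
  by apply: cvg_pair zc ztc.
have kz := cvg_comp _ _ zzc (kc (z t)).
have H := cvg_comp _ _ (cvg_mulmx _ zv kz) (@coord_continuous _ _ _ ord0 ord0 _).
have -> : (fun s => (s%:C)^-1 * (f (z (s + t)) - f (z t))) =
    (fun M : 'M[C]_1 => M ord0 ord0) \o
    (fun s : R => ((s%:C)^-1 *: (z (s + t) - z t)) *m k (z (s + t)) (z t)).
  by apply/funext => s; rewrite /= -scalemxAl [RHS]mxE fk.
exact: H.
Qed.

Lemma pgrad_bounded M (q : mpoly M C) (r : C) :
  exists2 c, 0 <= c & forall a, `|a| <= r -> `|pgrad q a| <= c.
Proof.
have /choice[e eP] : forall k, exists c, 0 <= c /\
    forall a, `|a| <= r -> `|peval (mderiv k q) a| <= c.
  by move=> k; have [c' c0 H] := peval_bounded (mderiv k q) r; exists c'.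
exists (\sum_k e k) => [|a ar]; first by apply: sumr_ge0 => k _; have [] := eP k.
apply: mx_norm_leP => [|k j]; first by apply: sumr_ge0 => k _; have [] := eP k.
rewrite mxE (bigD1 k) //=; apply: le_trans ((eP k).2 a ar) _.
by rewrite lerDl sumr_ge0 // => l _; have [] := eP l.
Qed.

(* A vector [u] tangent at [z] to the zero locus of [p] is [z] times the sum of an
   element of the Lie algebra, whose derivation preserves the ideal of [G], and a
   transversal part, which is controlled by the values at [z] of that ideal. *)
Lemma tangent_bound M (Q : 'I_M -> mpoly N C) b (r c1 c2 T0 z0 : C) :
  0 <= r -> 0 <= c1 -> 0 <= c2 -> 0 <= T0 ->
  (forall k, vanishes G (Q k) /\ (msize (Q k) <= b)%N) ->
  (forall p, vanishes G p -> (msize p <= b)%N ->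
    exists a : 'I_M -> C, forall z, peval p z = \sum_k a k * peval (Q k) z) ->
  (forall i, (msize (p i) <= b)%N) ->
  exists2 A, 0 <= A & forall (z u : 'rV[C]_N),
    (forall v : 'rV[C]_N, `|v| <= c1 * `|v *m ltrans z|) ->
    (forall v : 'rV[C]_N, `|v| <= c2 * `|v *m row_mx Bp (ltrans z *m P z)|) ->
    `|ltrans z| <= T0 -> `|z| <= z0 -> u *m P z = 0 -> `|u| <= r ->
    forall k, `|(u *m pgrad (Q k) z) ord0 ord0| <= A * \sum_l `|peval (Q l) z|.
Proof.
move=> r0 c10 c20 T00 IQ QS pb.
have BBp : B *m Bp = 1%:M by exact: mulmxVp.
have /choice[e eP] : forall i, exists e, 0 <= e /\ forall z (x : 'rV[C]_d),
   `|(x *m B *m ltrans z *m pgrad (p i) z) ord0 ord0| <=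
      e * `|x| * \sum_l `|peval (Q l) z|.
  by move=> i; have [e' ? ?] := derivation_bound GG BE QS (Ip i) (pb i); exists e'.
have /choice[a aP] : forall k, exists a, 0 <= a /\ forall z (x : 'rV[C]_d),
   `|(x *m B *m ltrans z *m pgrad (Q k) z) ord0 ord0| <=
      a * `|x| * \sum_l `|peval (Q l) z|.
  move=> k; have [IQk bQk] := IQ k.
  by have [a' ? ?] := derivation_bound GG BE QS IQk bQk; exists a'.
have /choice[gr grP] : forall k, exists c, 0 <= c /\
    forall a, `|a| <= z0 -> `|pgrad (Q k) a| <= c.
  by move=> k; have [c' c0 H] := pgrad_bounded (Q k) z0; exists c'.
(* [X] will bound the Lie algebra coordinates [x], and [Y * S] the transversal part [y]. *)
pose X : C := N%:R * (c1 * r * `|Bp|); have X0 : 0 <= X by rewrite !mulr_ge0.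
pose Y : C := c2 * ((\sum_i e i) * X).
have se0 : 0 <= \sum_i e i by apply: sumr_ge0 => i _; have [] := eP i.
have Y0 : 0 <= Y by rewrite !mulr_ge0.
pose A k : C := a k * X + N%:R * (Y * (N%:R * (T0 * gr k))).
have A0 k : 0 <= A k.
  have [a0 _] := aP k; have [g0 _] := grP k.
  by rewrite addr_ge0 // !mulr_ge0.
exists (\sum_k A k) => [|z u H1 H2 H3 H4 uP ur k]; first exact: sumr_ge0.
pose S := \sum_l `|peval (Q l) z|; rewrite -/S; have S0 : 0 <= S by apply: sumr_ge0.
have Tu : ltrans z \in unitmx.
  rewrite -row_free_unit; apply: inj_row_free => v v0.
  by apply/eqP; rewrite -normr_le0; have := H1 v; rewrite v0 normr0 mulr0.
pose v := u *m invmx (ltrans z).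
have vT : v *m ltrans z = u by rewrite mulmxKV.
pose x := v *m Bp; pose y := v - x *m B.
have vE : v = x *m B + y by rewrite addrC subrK.
have yB : y *m Bp = 0 by rewrite mulmxBl -[x *m B *m _]mulmxA BBp mulmx1 subrr.
clearbody y.
have xX : `|x| <= X.
  apply: le_trans (mulmx_norm _ _) _; rewrite ler_wpM2l // ler_wpM2r //.
  by apply: le_trans (H1 v) _; rewrite vT ler_wpM2l.
have yP : y *m (ltrans z *m P z) = - (x *m B *m ltrans z *m P z).
  apply/eqP; rewrite -subr_eq0 opprK; apply/eqP.
  by rewrite mulmxA -!mulmxDl addrC -vE vT.
(* In the system inverted with constant [c2], the first block of [y] is 0 by construction. The
   second is, up to sign, the derivative of the [p_i] along the Lie algebra part, because [u] is
   tangent; that derivative is bounded by a multiple of [S]. *)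
have yY : `|y| <= Y * S.
  apply: le_trans (H2 y) _; rewrite /Y -mulrA ler_wpM2l //.
  rewrite mul_mx_row yB yP; apply: mx_norm_leP => [|i j]; first by rewrite !mulr_ge0.
  rewrite mxE; case: (fintype.split j) => l; rewrite mxE ?normr0 ?mulr_ge0 //.
  rewrite normrN ord1 mul_pjacobian; have [_ H] := eP l.
  apply: le_trans (H _ _) _; rewrite ler_wpM2r // ler_pM //; first by have [] := eP l.
  by rewrite (bigD1 l) //= lerDl sumr_ge0 // => m _; have [] := eP m.
have AS : A k * S <= (\sum_k A k) * S.
  by rewrite ler_wpM2r // (bigD1 k) //= lerDl sumr_ge0.
apply: le_trans; last exact: AS.
rewrite -vT vE !mulmxDl mxE.
apply: le_trans (ler_normD _ _) _; rewrite mulrDl lerD //.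
  have [a0 H] := aP k; apply: le_trans (H _ _) _.
  by rewrite ler_wpM2r // ler_wpM2l.
apply: le_trans (mx_norm_entry _ _ _) _; rewrite -mulmxA.
apply: le_trans (mulmx_norm _ _) _; rewrite -mulrA ler_wpM2l // mulrAC ler_pM //.
apply: le_trans (mulmx_norm _ _) _; rewrite ler_wpM2l // ler_pM //.
by have [_] := grP k; apply.
Qed.

Theorem local_zero_locus : exists2 O : set 'rV[C]_N, nbhs one O &
  forall z, O z -> (forall i, peval (p i) z = 0) ->
    forall q, vanishes G q -> peval q z = 0.
Proof.
have BBp : B *m Bp = 1%:M by exact: mulmxVp.
have dP0 : forall v : 'rV[C]_N, v *m row_mx Bp (P one) = 0 -> v = 0.
  move=> v; rewrite mul_mx_row -[0]row_mx0 => /eq_row_mx[v1 /LE/submxP[u vE]].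
  by move: v1; rewrite vE -mulmxA BBp mulmx1 => ->; rewrite mul0mx.
have [J [KJ JK]] := square_inverse (esym dcN) dP0.
(* the map [z |-> ((z - 1) Bp, p z)] *)
pose F (j : 'I_(d + c)) : 'rV[C]_N -> C := match fintype.split j with
  | inl j => fun a => (a *m col j Bp) ord0 ord0 + - (one *m col j Bp) ord0 ord0
  | inr j => peval (p j) end.
pose dF (j : 'I_(d + c)) : 'rV[C]_N -> 'cV[C]_N := match fintype.split j with
  | inl j => fun a => col j Bp + 0
  | inr j => pgrad (p j) end.
have HF j : has_kernel (F j) (dF j).
  rewrite /F /dF; case: (fintype.split j) => k; last exact: peval_has_kernel.
  exact: (has_kernelD (has_kernel_lin _) (has_kernel_cst _ _)).
have [K [fK Kd]] := kernel_family HF.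
set f := fun a => _ in fK.
have KE a : K a a = row_mx Bp (P a).
  rewrite Kd; apply/matrixP => i j; rewrite !mxE /dF.
  by case: (fintype.split j) => k; rewrite !mxE ?addr0.
have fE a : f a = row_mx ((a - one) *m Bp) (\row_i peval (p i) a).
  apply/rowP => j; rewrite !mxE /F; case: (fintype.split j) => k; rewrite !mxE.
    by rewrite -sumrB; apply: eq_bigr => l _; rewrite !mxE mulrBl.
  by [].
have G1 : G 1%:M by case: GG.
have f1 : f one = 0.
  rewrite fE subrr mul0mx -[RHS]row_mx0; congr row_mx.
  by apply/rowP => i; rewrite !mxE Ip.
have cP : continuous P by exact: pjacobian_continuous.
have cK : {for one, continuous (fun z => row_mx Bp (P z))}.
  by apply: row_mx_continuous; [exact: cst_continuous|exact: cP].
have cM : {for one, continuous (fun z => row_mx Bp (ltrans z *m P z))}.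
  apply: row_mx_continuous; first exact: cst_continuous.
  exact: (cvg_mulmx _ (@ltrans_continuous R n one) (cP one)).
have [c0 c00 O0] : exists2 c : C, 0 <= c & \forall z \near one, forall v : 'rV[C]_N,
    `|v| <= c * `|v *m row_mx Bp (P z)|.
  exact: near_left_injective cK KJ.
have [c1 c10 O1] : exists2 c : C, 0 <= c & \forall z \near one, forall v : 'rV[C]_N,
    `|v| <= c * `|v *m ltrans z|.
  apply: (near_left_injective (J := 1%:M) (@ltrans_continuous R n one)).
  by rewrite ltrans1 mulmx1.
have [c2 c20 O2] : exists2 c : C, 0 <= c & \forall z \near one, forall v : 'rV[C]_N,
    `|v| <= c * `|v *m row_mx Bp (ltrans z *m P z)|.
  by apply: (near_left_injective (J := J) cM); rewrite ltrans1 mul1mx.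
have O3 : \forall z \near one, `|ltrans z| <= `|ltrans one| + 1.
  exact: (near_norm_bound (@ltrans_continuous R n one)).
have O4 : \forall z \near one, `|z| <= `|one| + 1.
  by apply: (@near_norm_bound _ _ _ id); exact: cvg_id.
(* The bound with [c0] controls the velocity of the curve below; the others are the hypotheses of
   [tangent_bound]. *)
pose O : set 'rV[C]_N := [set z |
  [/\ forall v : 'rV[C]_N, `|v| <= c0 * `|v *m row_mx Bp (P z)|,
      forall v : 'rV[C]_N, `|v| <= c1 * `|v *m ltrans z|,
      forall v : 'rV[C]_N, `|v| <= c2 * `|v *m row_mx Bp (ltrans z *m P z)|,
      `|ltrans z| <= `|ltrans one| + 1 & `|z| <= `|one| + 1]].
have OO : nbhs one O.
  apply: filterS (filterI O0 (filterI O1 (filterI O2 (filterI O3 O4)))).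
  by move=> z [? [? [? []]]].
have KJ' : K one one *m J = 1%:M by rewrite KE.
have JK' : J *m K one one = 1%:M by rewrite KE.
have [U [e [h [[oU U1 UO e0] fU hU dh]]]] := inverse_function fK KJ' JK' OO.
exists U; first by apply: open_nbhs_nbhs.
move=> z1 Uz1 Pz1 q Iq.
pose w := f z1.
have [we hw] : `|w| < e /\ h w = z1.
  by have := fU _ Uz1; rewrite f1 sub0r normrN.
(* The preimage of the segment from 0 to [f z1]. Since [f z1] has zero second block, so has each of
   its multiples, and the curve stays in the zero locus of [p]. *)
pose z (t : R) : 'rV[C]_N := h (t%:C *: w).
have z0E : z 0 = one by rewrite /z scale0r -f1; have [] := fU _ U1.
have z1E : z 1 = z1 by rewrite /z scale1r.
have tw t : 0 <= t <= 1 -> `|f one - t%:C *: w| < e.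
  move=> /andP[t0 t1]; rewrite f1 sub0r normrN normrZ normc_real ger0_norm //.
  by apply: le_lt_trans we; rewrite ler_piMl // lecR.
have fz t : 0 <= t <= 1 -> f (z t) = t%:C *: w.
  by move=> /tw/hU[].
have Uz t : 0 <= t <= 1 -> U (z t) by move=> /tw/hU[].
have wr : rsubmx w = 0.
  rewrite /w fE row_mxKr; apply/rowP => i; rewrite !mxE; exact: Pz1.
have zd t : 0 <= t <= 1 -> exists v : 'rV[C]_N,
    [/\ (s%:C)^-1 *: (z (s + t) - z t) @[s --> (0 : R)^'] --> v,
        v *m P (z t) = 0 & `|v| <= c0 * `|w|].
  move=> t01; have [D DK hd] := dh _ (tw t t01).
  exists (w *m D); rewrite -/(z t) KE in DK *.
  have wDK : w *m D *m row_mx Bp (P (z t)) = w by rewrite -mulmxA DK mulmx1.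
  split.
  - have -> : w *m D = mulmxr D w by [].
    exact: (is_diff_real_line hd).
  - have := congr1 rsubmx wDK; rewrite wr mul_mx_row row_mxKr; exact.
  - by have [/(_ (w *m D)) + _] := UO _ (Uz t t01); rewrite wDK.
(* The bound covers the [p_i] too, since their derivatives enter the estimate of the transversal
   part. *)
pose b := maxn (msize q) (\max_i msize (p i)).
have [M [Q [IQ QS]]] := vanishing_span G b.
have qb : (msize q <= b)%N by rewrite leq_maxl.
have pb i : (msize (p i) <= b)%N by rewrite leq_max; apply/orP; right; exact: (leq_bigmax i).
have zD t : exists v : 'rV[C]_N, 0 <= t <= 1 ->
    [/\ (s%:C)^-1 *: (z (s + t) - z t) @[s --> (0 : R)^'] --> v,
        v *m P (z t) = 0 & `|v| <= c0 * `|w|].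
  have [/zd[v vP]|_] := boolP (0 <= t <= 1); first by exists v.
  by exists 0.
have {zd zD}[dz dzE] := choice zD.
pose W k t := peval (Q k) (z t).
pose W' k t := (dz t *m pgrad (Q k) (z t)) ord0 ord0.
have Wd k t : 0 <= t <= 1 ->
    (s%:C)^-1 * (W k (s + t) - W k t) @[s --> (0 : R)^'] --> W' k t.
  by move=> /dzE[zv _ _]; exact: has_kernel_curve (peval_has_kernel _) zv.
have [A A0 AW] : exists2 A : R, 0 <= A & forall k t, 0 <= t <= 1 ->
    `|W' k t| <= A%:C * \sum_l `|W l t|.
  have [A A0 AP] := tangent_bound (`|one| + 1) (mulr_ge0 c00 (normr_ge0 w)) c10 c20
    (addr_ge0 (normr_ge0 (ltrans one)) ler01) IQ QS pb.
  exists (complex.Re A); first by move: A0; rewrite lecE => /andP[].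
  move=> k t t01; have [_ H1 H2 H3 H4] := UO _ (Uz t t01).
  have [_ vP vw] := dzE t t01.
  by rewrite RRe_real ?ger0_real //; apply: AP.
have W0 k : W k 0 = 0 by rewrite /W z0E (IQ k).1.
have W1 := gronwall_zero A0 Wd AW W0.
have [a aE] := QS q Iq qb.
rewrite aE big1 // => k _; have := W1 k; rewrite /W z1E => ->.
by rewrite mulr0.
Unshelve. all: by end_near. Qed.
End ZeroLocus.

(** * Transversality of the slice *)

Section Sl2.
Variables (K : numFieldType) (m n : nat).
Local Notation V := 'M[K]_(m, n).

Lemma injective_surjective_on (S : V -> Prop) (f : {linear V -> V}) :
  S 0 -> (forall a u v, S u -> S v -> S (a *: u + v)) ->
  (forall v, S v -> S (f v)) -> (forall v, S v -> f v = 0 -> v = 0) ->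
  forall w, S w -> exists2 v, S v & f v = w.
Proof.
move=> S0 SL Sf fi w Sw.
have [||d [B [fB BE]]] := @subspace_basis K (m * n) (fun r => S (vec_mx r)).
- by rewrite linear0.
- by move=> a u v Su Sv; rewrite linearP; exact: SL.
have BfB : (B *m lin_mx f <= B)%MS.
  apply/row_subP => i; apply/BE; rewrite row_mul mul_rV_lin mxvecK; apply: Sf.
  by apply/BE; exact: row_sub.
have fBf : row_free (B *m lin_mx f).
  apply: inj_row_free => v; rewrite mulmxA mul_rV_lin => /(congr1 vec_mx).
  rewrite mxvecK linear0 => /fi H.
  have vB0 : v *m B = 0.
    by rewrite -[v *m B]vec_mxK H ?linear0 //; apply/BE; exact: submxMl.
  by apply: (row_free_inj fB); rewrite vB0 mul0mx.
have : (B <= B *m lin_mx f)%MS.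
  by rewrite -(mxrank_leqif_sup BfB) (eqP fB) (eqP fBf).
have wB : (mxvec w <= B)%MS by apply/BE; rewrite mxvecK.
move=> /(submx_trans wB)/submxP[u uE]; exists (vec_mx (u *m B)).
  by apply/BE; exact: submxMl.
by apply: (can_inj mxvecK); rewrite uE mulmxA mul_rV_lin.
Qed.

(** [S] will be the Lie algebra inside the matrices, and [E], [F], [H] the operators [ad xi],
    [ad eta], [ad h]. *)
Variables (S : V -> Prop) (E F H : {linear V -> V}).
Hypotheses (S0 : S 0) (SL : forall a u v, S u -> S v -> S (a *: u + v)).
Hypotheses (SE : forall v, S v -> S (E v)) (SF : forall v, S v -> S (F v))
  (SH : forall v, S v -> S (H v)).
Hypotheses (EF : forall v, E (F v) - F (E v) = H v)
  (HF : forall v, H (F v) - F (H v) = - 2 *: F v).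
Variable e : nat.
Hypothesis En : forall v, S v -> iter e E v = 0.

Lemma iter_lin (f : {linear V -> V}) k a u v :
  iter k f (a *: u + v) = a *: iter k f u + iter k f v.
Proof. by elim: k => //= k ->; rewrite linearP. Qed.

Lemma iter0 (f : {linear V -> V}) k : iter k f 0 = 0.
Proof. by elim: k => //= k ->; rewrite linear0. Qed.

Lemma iterZ (f : {linear V -> V}) k a u : iter k f (a *: u) = a *: iter k f u.
Proof. by rewrite -[a *: u]addr0 iter_lin iter0 addr0. Qed.

Lemma iterF_H k v : iter k F (H v) = H (iter k F v) + (2 * k%:R) *: iter k F v.
Proof.
elim: k v => [|k IH] v; first by rewrite mulr0 scale0r addr0.
rewrite iterS IH linearD linearZ /= -iterS.
have -> : F (H (iter k F v)) = H (F (iter k F v)) + 2 *: F (iter k F v).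
  by move: (HF (iter k F v)) => /eqP; rewrite subr_eq scaleNr => /eqP ->; rewrite addrAC addNr add0r.
by rewrite -addrA -scalerDl iterS; congr (_ + _ *: _); rewrite -natr1; ring.
Qed.

Lemma iterF_shift k c v :
  iter k F (H v - c *: v) = H (iter k F v) + (2 * k%:R - c) *: iter k F v.
Proof.
by rewrite addrC -scaleNr iter_lin iterF_H addrCA -scalerDl [- c + _]addrC.
Qed.

(** Iterates [F E = E F - H], each step moving one more [F] past [H]. *)
Lemma iterF_E k v : iter k.+1 F (E v) =
  E (iter k.+1 F v) - k.+1%:R *: iter k F (H v - k%:R *: v).
Proof.
have FE u : F (E u) = E (F u) - H u.
  by rewrite -EF opprB addrC subrK.
elim: k => [|k IH]; first by rewrite /= FE scale0r subr0 scale1r.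
rewrite iterS IH linearB linearZZ FE -!iterS !iterF_shift.
set u := iter k.+1 F v; set w := H u; set x := E _.
by apply/matrixP => i j; rewrite !mxE -!natr1; ring.
Qed.

(* [F^(k+s) E^s v] is a nonzero multiple of [F^k v] for every [s], whereas [E] is
   nilpotent: a string through [v] ending at weight [1 - k] would be too short. *)
Lemma lowest_weight_vanish k v : S v -> F (iter k F v) = 0 ->
  H (iter k F v) = (1 - k%:R) *: iter k F v -> iter k F v = 0.
Proof.
move=> Sv Fu Hu; set u := iter k F v in Fu Hu *.
have SEs s : S (iter s E v) by elim: s => //= s; exact: SE.
have [c c0 cE] : exists2 c, c != 0 & iter (k + e) F (iter e E v) = c *: u.
  elim: e => [|s [c c0 cE]]; first by exists 1; rewrite ?oner_eq0 // addn0 scale1r.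
  (* In [iterF_E] the term with [E] vanishes as [F u = 0]. Moved past [F^(k+s)], [H - (k + s)]
     becomes [H + (k + s)], which acts on [u] by [1 - k + k + s = s + 1]. *)
  exists (- ((k + s).+1%:R * s.+1%:R * c)).
    by rewrite oppr_eq0 !mulf_neq0 ?pnatr_eq0.
  rewrite addnS [iter s.+1 E v]iterS iterF_E iterS cE linearZZ Fu scaler0 linear0 sub0r.
  have Hcu : H (c *: u) = (c * (1 - k%:R)) *: u by rewrite linearZZ Hu scalerA.
  rewrite iterF_shift cE Hcu !scalerA -!scalerDl.
  rewrite scalerA -scaleNr; congr (_ *: _).
  by rewrite natrD -!natr1 natrD; ring.
move: cE; rewrite En // iter0 => /esym/eqP; rewrite scaler_eq0 (negbTE c0) /=.
by move/eqP.
Qed.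

(* By [lowest_weight_vanish], [H + k] is injective, hence onto, on the image of
   [ker F^(k+2)] under [F^(k+1)]; this solves [F^(k+1) (E a - v) = 0] for [a]. *)
Lemma kernel_decomposition k v : S v -> iter k.+1 F v = 0 ->
  exists a b, [/\ S a, S b, iter k F a = 0, F b = 0 & v = E a + b].
Proof.
elim: k v => [|k IH] v Sv Fv.
  by exists 0, v; split => //; rewrite linear0 add0r.
pose U w := exists v', [/\ S v', iter k.+2 F v' = 0 & w = iter k.+1 F v'].
pose T := fun w : V => k%:R *: w + H w.
have Tl : linear T.
  move=> a x y.
  by rewrite /T (linearP H); apply/matrixP => i j; rewrite !mxE; ring.
pose TM := GRing.isLinear.Build _ _ _ _ _ Tl.
pose TL : {linear V -> V} := HB.pack T TM.
have U0 : U 0 by exists 0; rewrite !iter0.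
have UL a x y : U x -> U y -> U (a *: x + y).
  move=> [x' [Sx Fx ->]] [y' [Sy Fy ->]]; exists (a *: x' + y').
  by rewrite !iter_lin Fx Fy scaler0 addr0; split=> //; exact: SL.
have UT w : U w -> U (TL w).
  move=> [w' [Sw Fw ->]]; exists ((k%:R - 2 * k.+1%:R) *: w' + H w').
  rewrite !iter_lin !iterF_H Fw linear0 !scaler0 !addr0; split=> //.
    by apply: SL => //; exact: SH.
  by rewrite /= /T addrCA -scalerDl subrK addrC.
(* A kernel vector has weight [- k = 1 - (k + 1)], the case excluded by [lowest_weight_vanish] at
   [k + 1]. *)
have Ui w : U w -> TL w = 0 -> w = 0.
  move=> [w' [Sw Fw ->]] /= T0; apply: (@lowest_weight_vanish k.+1) => //.
  move/eqP: T0; rewrite /T addrC addr_eq0 => /eqP ->.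
  by rewrite -scaleNr; congr (_ *: _); rewrite -natr1; ring.
have Uv : U (iter k.+1 F v) by exists v.
have [_ [v' [Sv' Fv' ->]] /= Tv'] := injective_surjective_on U0 UL UT Ui Uv.
(* By [iterF_E], [F^(k+1) E F v'] equals [- (k + 1) (H + k) F^(k+1) v'], because [F^(k+2) v' = 0];
   the scalar cancels [- (k + 1)]. *)
pose a1 := - (k.+1%:R)^-1 *: F v'.
have Sa1 : S a1 by rewrite -[a1]addr0; apply: SL => //; exact: SF.
have k0 : k.+1%:R != 0 :> K by rewrite pnatr_eq0.
have Fa1 : iter k.+1 F a1 = 0 by rewrite iterZ -iterSr Fv' scaler0.
have FEa1 : iter k.+1 F (E a1) = iter k.+1 F v.
  rewrite /a1 linearZZ iterZ iterF_E -iterSr Fv' linear0 sub0r.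
  rewrite scalerN -scaleNr opprK scalerA mulVf // scale1r.
  rewrite iterF_shift -!iterSr; apply: etrans Tv'; rewrite /T addrC.
  by congr (_ *: _ + _); rewrite -natr1; ring.
have Sv1 : S (v - E a1).
  by rewrite -scaleN1r addrC; apply: SL => //; exact: SE.
have Fv1 : iter k.+1 F (v - E a1) = 0.
  by rewrite -scaleN1r addrC iter_lin FEa1 scaleN1r addNr.
have [a [b [Sa Sb Fa Fb vE]]] := IH _ Sv1 Fv1.
exists (a1 + a), b; split => //.
- by rewrite -[a1]scale1r; exact: SL.
- change (iter k.+1 F (a1 + a) = 0); have := iter_lin F k.+1 1 a1 a.
  by rewrite scale1r Fa1 scaler0 add0r => ->; rewrite /= Fa linear0.
- by rewrite linearD -addrA -vE addrC subrK.
Qed.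

Lemma transversal (Z : {linear V -> V}) k v :
  (forall v, S v -> S (Z v)) -> (forall v, F (Z v) = Z (F v)) ->
  S v -> iter k F v = 0 ->
  exists a b, [/\ S a, S b, F b = 0 & v = E a + Z a + b].
Proof.
move=> SZ FZ; elim: k v => [|k IH] v Sv Fv.
  by exists 0, 0; rewrite !linear0 !addr0.
have [a [b [Sa Sb Fa Fb vE]]] := kernel_decomposition Sv Fv.
have FkZ j w : iter j F (Z w) = Z (iter j F w).
  by elim: j => //= j ->; rewrite FZ.
have SZa : S (- Z a) by rewrite -scaleN1r -[_ *: _]addr0; apply: SL => //; exact: SZ.
have FZa : iter k F (- Z a) = 0 by rewrite -scaleN1r iterZ FkZ Fa linear0 scaler0.
(* Replacing [E a] by [(E + Z) a] costs [Z a]; the induction hypothesis is used on [- Z a] to absorb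
   it. *)
have [a' [b' [Sa' Sb' Fb' aE]]] := IH _ SZa FZa.
exists (a + a'), (b + b'); split.
- by rewrite -[a]scale1r; exact: SL.
- by rewrite -[b]scale1r; exact: SL.
- by rewrite linearD Fb Fb' addr0.
- rewrite vE !linearD /= -[in LHS](addrK (Z a) (E a)) aE.
  by apply/matrixP => i j; rewrite !mxE; ring.
Qed.

End Sl2.

(** * Brackets, the adjoint action and the slice inside the Lie algebra *)

Section LieFacts.
Variables (R : realType) (n : nat).
Local Notation C := R[i].
Variable G : set 'M[C]_n.
Hypothesis GG : subgroup_GL G.
Local Notation N := (n * n)%N.
Local Notation g := (Lie_algebra G).

Lemma lie_is_linear (X : 'M[C]_n) : linear (lie X).
Proof.
move=> a u v; rewrite /lie mulmxDr mulmxDl -scalemxAr -scalemxAl.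
by rewrite opprD addrACA scalerBr.
Qed.

Definition lie_linear (X : 'M[C]_n) : {linear 'M[C]_n -> 'M[C]_n} :=
  HB.pack (lie X) (GRing.isLinear.Build _ _ _ _ _ (lie_is_linear X)).

Lemma lieC (X Y : 'M[C]_n) : lie X Y = - lie Y X.
Proof. by rewrite /lie opprB. Qed.

Lemma lieZl a (X Y : 'M[C]_n) : lie (a *: X) Y = a *: lie X Y.
Proof. by rewrite /lie -scalemxAl -scalemxAr scalerBr. Qed.

Lemma lie0l (X : 'M[C]_n) : lie 0 X = 0.
Proof. by rewrite /lie mul0mx mulmx0 subrr. Qed.

Lemma lieDl (X X' Y : 'M[C]_n) : lie (X + X') Y = lie X Y + lie X' Y.
Proof. by rewrite /lie mulmxDl mulmxDr opprD addrACA. Qed.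

Lemma lie_jacobi (X Y Z : 'M[C]_n) :
  lie X (lie Y Z) - lie Y (lie X Z) = lie (lie X Y) Z.
Proof.
rewrite /lie !(mulmxBl, mulmxBr) !mulmxA.
move: (X *m Y *m Z) (X *m Z *m Y) (Y *m Z *m X) (Z *m Y *m X) (Y *m X *m Z)
  (Z *m X *m Y) => a b c' d e' f.
by apply/matrixP => i j; rewrite !mxE; ring.
Qed.

Lemma AdK a (X : 'M[C]_n) : a \in unitmx -> Ad (invmx a) (Ad a X) = X.
Proof.
by move=> au; rewrite /Ad invmxK !mulmxA mulVmx // mul1mx -mulmxA mulVmx // mulmx1.
Qed.

Lemma AdKV a (X : 'M[C]_n) : a \in unitmx -> Ad a (Ad (invmx a) X) = X.
Proof. by move=> au; rewrite -{1}[a]invmxK AdK // unitmx_inv. Qed.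

Lemma Ad_lie a (X Y : 'M[C]_n) : a \in unitmx -> Ad a (lie X Y) = lie (Ad a X) (Ad a Y).
Proof.
move=> au; have H (U W : 'M[C]_n) : Ad a U *m Ad a W = Ad a (U *m W).
  by rewrite /Ad !mulmxA mulmxKV.
by rewrite /lie !H /Ad mulmxBr mulmxBl.
Qed.

Lemma nilpotent_Ad e a : nilpotent_element G e -> G a ->
  exists k, forall y, g y -> iter k (lie (Ad a e)) y = 0.
Proof.
move=> [ge [k ek]] Ga; exists k => y gy.
have [Gu _ _ GV] := GG; have au := Gu _ Ga.
have H j : iter j (lie (Ad a e)) y = Ad a (iter j (lie e) (Ad (invmx a) y)).
  elim: j => [|j IH]; first by rewrite /= AdKV.
  by rewrite !iterS IH Ad_lie.
rewrite H ek /Ad ?mulmx0 ?mul0mx //.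
by apply: (Lie_algebra_Ad GG) => //; exact: GV.
Qed.

Lemma nilpotent_orbit_ad rk O X : regular_nilpotent_orbit G rk O -> O X ->
  exists k, forall y, g y -> iter k (lie X) y = 0.
Proof.
by move=> [[e ne ->] _] [a Ga <-]; exact: nilpotent_Ad.
Qed.

Lemma slice_transversal xi h eta y v :
  sl2_triple G xi h eta ->
  (exists k, forall y, g y -> iter k (lie xi) y = 0) ->
  (exists k, forall y, g y -> iter k (lie eta) y = 0) ->
  Slodowy_slice G xi eta y -> g v ->
  exists a b, [/\ g a, centralizer_Lie G eta b & v = lie a y + b].
Proof.
move=> [[gxi gh geta] [xieta hxi heta]] [k1 xin] [k2 etan] [z [gz etaz] <-] gv.
have gL X : g X -> forall v, g v -> g (lie_linear X v).
  by move=> gX w gw; exact: Lie_algebra_lie.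
have HF w : lie h (lie eta w) - lie eta (lie h w) = - 2 *: lie eta w.
  by rewrite lie_jacobi heta lieZl.
have EF w : lie xi (lie eta w) - lie eta (lie xi w) = lie h w.
  by rewrite lie_jacobi xieta.
have FZ w : lie eta (lie z w) = lie z (lie eta w).
  by apply/eqP; rewrite -subr_eq0 lie_jacobi etaz lie0l.
have := @transversal C n n g (lie_linear xi) (lie_linear eta) (lie_linear h)
  (@Lie_algebra0 R n G) (@Lie_algebra_lin R n G) (gL _ gxi) (gL _ geta) (gL _ gh)
  EF HF k1 xin (lie_linear z) k2 v (gL _ gz) FZ gv (etan v gv).
(* The sign turns [lie y a], with [y = xi + z], into [lie (- a) y]. *)
move=> [a [b [ga gb etab vE]]]; exists (- a), b; split => //.
  by rewrite -scaleN1r -[_ *: _]addr0; apply: Lie_algebra_lin => //; exact: Lie_algebra0.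
by rewrite -scaleN1r lieZl scaleN1r -lieC lieDl vE.
Qed.

(** Converts a dimension given through [vspace] into a free matrix with exactly [r] rows, the form
    in which ranks are counted later. *)
Lemma has_dim_basis (A : set 'M[C]_n) r : has_dim A r ->
  exists B : 'M[C]_(r, N), row_free B /\ forall X, A X <-> (mxvec X <= B)%MS.
Proof.
move=> [V AE Vr].
have [||d [B [fB BE]]] := @subspace_basis C N (fun v => A (vec_mx v)).
- by rewrite linear0 AE /= mem0v.
- by move=> a u v; rewrite AE /= linearP => uV vV; rewrite rpredD ?rpredZ.
suff dr : d = r.
  move: B fB BE; rewrite dr => B fB BE; exists B; split=> // X.
  by rewrite -BE mxvecK.
pose f (u : 'rV[C]_d) : 'M[C]_n := vec_mx (u *m B).
have fl : linear f by move=> a u v; rewrite /f mulmxDl -scalemxAl linearP.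
pose fM := GRing.isLinear.Build _ _ _ _ _ fl.
pose fL : {linear 'rV[C]_d -> 'M[C]_n} := HB.pack f fM.
have VE : V = limg (linfun fL).
  apply/vspaceP => X; apply/idP/memv_imgP => [XV|[u _ ->]].
    have /BE/submxP[u uE] : A (vec_mx (mxvec X)) by rewrite AE mxvecK.
    by exists u; rewrite ?memvf // lfunE /= /f -uE mxvecK.
  rewrite lfunE /= /f; have : A (vec_mx (u *m B)) by apply/BE; exact: submxMl.
  by rewrite AE.
rewrite -Vr VE limg_dim_eq ?dimvf /dim /= ?mul1n //.
apply/eqP; rewrite -subv0; apply/subvP => u; rewrite memv_cap memv_ker.
move=> /andP[_ /eqP fu0]; have fu : f u = 0 by rewrite -fu0; symmetry; exact: (lfunE fL).
 rewrite memv0; apply/eqP/(row_free_inj fB).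
by rewrite mul0mx -[u *m B]vec_mxK -/(f u) fu linear0.
Qed.

Lemma slice_sub xi h eta y : sl2_triple G xi h eta -> Slodowy_slice G xi eta y -> g y.
Proof.
move=> [[gxi _ _] _] [z [gz _] <-].
by rewrite -[xi]scale1r; exact: Lie_algebra_lin.
Qed.

End LieFacts.

(** * Charts adapted to the fibre *)

Section LinearAlgebra.
Variable F : fieldType.

Lemma surjective_of_kernel N d c (B : 'M[F]_(d, N)) (L : 'M[F]_(N, c)) :
  row_free B -> (d + c = N)%N -> (forall v : 'rV_N, v *m L = 0 <-> (v <= B)%MS) ->
  forall u : 'rV_c, exists v, v *m L = u.
Proof.
move=> fB dcN LB u.
have kB : (kermx L == B)%MS.
  apply/andP; split; apply/row_subP => i.
    by apply/LB; rewrite -row_mul mulmx_ker row0.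
  by apply/sub_kermxP/LB/row_sub.
have rL : \rank L = c.
  have : \rank (kermx L) = d by rewrite (eqmxP kB) (eqP fB).
  by rewrite mxrank_ker; have := rank_leq_row L; lia.
have fL : row_full L by rewrite /row_full rL.
by have /submxP[v ->] := submx_full u fL; exists v.
Qed.

Lemma annihilator_matrix N r (B : 'M[F]_(r, N)) : row_free B ->
  exists c (L : 'M[F]_(N, c)), (r + c = N)%N /\
    forall v : 'rV_N, v *m L = 0 <-> (v <= B)%MS.
Proof.
move=> fB; pose M := (cokermx B)^T.
exists (\rank M), (row_base M)^T; split.
  rewrite mxrank_tr mxrank_coker (eqP fB) subnKC //.
  by rewrite -(eqP fB) rank_leq_col.
move=> v; rewrite submxE -[cokermx B]trmxK -/M.
have /submxP[X XE] : (M <= row_base M)%MS by rewrite eq_row_base.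
have /submxP[Y YE] : (row_base M <= M)%MS by rewrite eq_row_base.
split=> [H|/eqP H].
  by rewrite XE trmx_mul mulmxA H mul0mx.
by rewrite YE trmx_mul mulmxA H mul0mx.
Qed.

(** [L] extends the coordinates with respect to a basis of the kernel of [K], so a vector killed by
    both matrices is 0. *)
Lemma complete_to_injective N r c (K : 'M[F]_(N, c)) : (r + c = N)%N ->
  (forall u : 'rV_c, exists v, v *m K = u) ->
  exists L : 'M[F]_(N, r), forall v : 'rV_N, v *m L = 0 -> v *m K = 0 -> v = 0.
Proof.
move=> rcN Ks.
have fK : row_full K.
  apply/row_fullP.
  have /choice[v vE] : forall i : 'I_c, exists v : 'rV[F]_N, v *m K = delta_mx ord0 i.
    by move=> i; exact: Ks.
  exists (\matrix_i v i); apply/row_matrixP => i.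
  by rewrite row_mul rowK vE row1.
have : \rank (kermx K) = r by rewrite mxrank_ker (eqP fK) -rcN addnK.
move=> <-; exists (pinvmx (row_base (kermx K))) => v vL vK.
have /submxP[u uE] : (v <= row_base (kermx K))%MS by rewrite eq_row_base; apply/sub_kermxP.
by move: vL; rewrite uE -mulmxA mulmxVp ?row_base_free // mulmx1 => ->; rewrite mul0mx.
Qed.

End LinearAlgebra.

(** * Connectedness of star-shaped sets *)

Section Connected.
Variable R : realType.
Local Notation C := R[i].

Lemma star_connected (V : normedModType C) (A : set V) : A 0 ->
  (forall v (t : R), A v -> 0 <= t <= 1 -> A (t%:C *: v)) -> connected A.
Proof.
move=> A0 AS.
have -> : A = \bigcup_(v in A) ((fun t : R => t%:C *: v) @` `[0, 1]%classic).
  apply/seteqP; split=> [v Av|_ [v Av [t /= + <-]]].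
    by exists v => //; exists 1; rewrite ?scale1r //= in_itv /= ler01 lexx.
  by rewrite in_itv /= => t01; exact: AS.
apply: bigcup_connected.
  by exists 0 => v Av; exists 0; rewrite ?scale0r //= in_itv /= lexx ler01.
move=> v Av; apply: connected_continuous_connected; first exact: segment_connected.
apply: continuous_subspaceT => t.
have tc : (s%:C : C) @[s --> t] --> t%:C.
  apply/(@cvgrPdist_lt _ _ _ (nbhs t)) => _ /gt0_complex[e e0 ->].
  near=> s; rewrite -rmorphB normc_real ltcR.
  by near: s; apply: cvgr_dist_lt.
exact: (cvg_comp _ _ tc (@scalel_continuous _ _ v _)).
Unshelve. all: by end_near. Qed.

End Connected.

Lemma difference_kernel_mulmxr (R : realType) N N1 N2 (f : 'rV[R[i]]_N -> 'rV[R[i]]_N1) K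
    (T : 'M[R[i]]_(N1, N2)) :
  difference_kernel f K -> difference_kernel (fun a => f a *m T) (fun a b => K a b *m T).
Proof.
move=> [fK Kc]; split=> [a b|a e e0]; first by rewrite -mulmxBl fK mulmxA.
have k0 : 0 < N1%:R * `|T| + 1 by rewrite ltr_wpDl // mulr_ge0.
have [d d0 H] := Kc a _ (divr_gt0 e0 k0); exists d => // b c ba ca.
rewrite -mulmxBl; apply: le_lt_trans (mulmx_norm _ _) _; rewrite mulrCA.
have := H b c ba ca; rewrite ltr_pdivlMr //; apply: le_lt_trans.
by rewrite ler_wpM2l // lerDl.
Qed.

(** * Row coordinates on pairs of matrices, and the polynomial form of the fibre equation *)

Section PairRow.
Variables (R : realType) (n : nat).
Local Notation C := R[i].
Local Notation N := (n * n)%N.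
Local Notation E := ('M[C]_n * 'M[C]_n)%type.

Definition pair_row (q : E) : 'rV[C]_(N + N) := row_mx (mxvec q.1) (mxvec q.2).

Definition row_pair (a : 'rV[C]_(N + N)) : E := (vec_mx (lsubmx a), vec_mx (rsubmx a)).

Lemma pair_rowK : cancel pair_row row_pair.
Proof. by case=> A Y; rewrite /row_pair row_mxKl row_mxKr !mxvecK. Qed.

Lemma row_pairK : cancel row_pair pair_row.
Proof. by move=> a; rewrite /pair_row !vec_mxK hsubmxK. Qed.

Lemma mxvec_continuous : continuous (mxvec : 'M[C]_n -> 'rV[C]_N).
Proof.
apply: (@linear_bound_continuous _ _ _ _ 1) => // A.
rewrite mul1r; apply: mx_norm_leP => // i j.
by case/mxvec_indexP: j => k l; rewrite ord1 mxvecE mx_norm_entry.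
Qed.

Lemma pair_row_is_linear : linear pair_row.
Proof.
by move=> a [A Y] [A' Y']; rewrite /pair_row /= !linearP scale_row_mx add_row_mx.
Qed.

Lemma row_pair_is_linear : linear row_pair.
Proof. by move=> a u v; rewrite /row_pair !linearP. Qed.

Lemma pair_row_continuous : continuous pair_row.
Proof.
move=> q.
have c1 : {for q, continuous (fun q : E => mxvec q.1)}.
  by apply: (@cvg_comp _ _ _ fst mxvec); [exact: cvg_fst|exact: mxvec_continuous].
have c2 : {for q, continuous (fun q : E => mxvec q.2)}.
  by apply: (@cvg_comp _ _ _ snd mxvec); [exact: cvg_snd|exact: mxvec_continuous].
exact: (row_mx_continuous c1 c2).
Qed.

Lemma pair_row_differentiable q : differentiable pair_row q.
Proof.
pose lM := GRing.isLinear.Build _ _ _ _ _ pair_row_is_linear.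
pose l : {linear E -> 'rV[C]_(N + N)} := HB.pack pair_row lM.
exact: (@linear_differentiable _ _ _ l _ pair_row_continuous).
Qed.

Lemma row_pair_differentiable a : differentiable row_pair a.
Proof.
pose lM := GRing.isLinear.Build _ _ _ _ _ row_pair_is_linear.
pose l : {linear 'rV[C]_(N + N) -> E} := HB.pack row_pair lM.
exact: (@linear_differentiable _ _ _ l _ (@linear_rV_continuous _ _ _ l)).
Qed.

Definition rtrans (z : 'rV[C]_N) : 'M[C]_N := lin_mulmxr (vec_mx z : 'M[C]_n).

Lemma mul_rtrans z (X : 'M[C]_n) : mxvec X *m rtrans z = mxvec (X *m vec_mx z).
Proof. exact: mul_vec_lin. Qed.

Lemma rtrans_continuous : continuous rtrans.
Proof.
have lin : linear rtrans.
  move=> a u v; apply/row_matrixP => i.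
  rewrite !rowE mulmxDr -scalemxAr.
  have E' z : delta_mx ord0 i *m rtrans z = mxvec (vec_mx (delta_mx ord0 i) *m vec_mx z).
    by rewrite -mul_rtrans vec_mxK.
  have vL : vec_mx (a *: u + v) = a *: vec_mx u + vec_mx v :> 'M[C]_n by exact: linearP.
  by rewrite (E' (a *: u + v)) (E' u) (E' v) vL mulmxDr -scalemxAr; exact: linearP.
pose lM := GRing.isLinear.Build _ _ _ _ _ lin.
pose lL : {linear _ -> _} := HB.pack rtrans lM.
exact: (@linear_rV_continuous R N _ lL).
Qed.

Lemma rtrans_ltrans (u z : 'rV[C]_N) : u *m rtrans z = z *m ltrans u.
Proof. by rewrite -{1}[u]vec_mxK mul_rtrans -{2}[z]vec_mxK mul_ltrans. Qed.

Definition projl : 'M[C]_(N + N, N) := col_mx 1%:M 0.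
Definition projr : 'M[C]_(N + N, N) := col_mx 0 1%:M.

Lemma mul_projl (m : nat) (a : 'M[C]_(m, N + N)) : a *m projl = lsubmx a.
Proof. by rewrite -{1}[a]hsubmxK mul_row_col mulmx1 mulmx0 addr0. Qed.

Lemma mul_projr (m : nat) (a : 'M[C]_(m, N + N)) : a *m projr = rsubmx a.
Proof. by rewrite -{1}[a]hsubmxK mul_row_col mulmx1 mulmx0 add0r. Qed.

(* [(A, Y) |-> Y A + A x] in coordinates: the equation [- A^-1 Y A = x] of the
   fibre multiplied by [A], which makes it polynomial. *)
Definition quad (x : 'M[C]_n) (a : 'rV[C]_(N + N)) : 'rV[C]_N :=
  a *m projr *m rtrans (a *m projl) + a *m projl *m lin_mulmxr x.

(** From [Y A - Y' A' = (Y - Y') A + Y' (A - A')]: the group variable is taken from [a], the slice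
    variable from [b]. *)
Definition quad_kernel (x : 'M[C]_n) (a b : 'rV[C]_(N + N)) : 'M[C]_(N + N, N) :=
  projr *m rtrans (a *m projl) + projl *m (ltrans (b *m projr) + lin_mulmxr x).

Lemma quadE x A Y : quad x (pair_row (A, Y)) = mxvec (Y *m A + A *m x).
Proof.
rewrite /quad mul_projl mul_projr row_mxKl row_mxKr mul_rtrans mxvecK /=.
by rewrite (mul_vec_lin (mulmxr x)) -linearD.
Qed.

Lemma quad_kernelE x u U V A Y :
  u = pair_row (U, V) -> u *m quad_kernel x (pair_row (A, Y)) (pair_row (A, Y)) =
  mxvec (V *m A + Y *m U + U *m x).
Proof.
have lE B Z : pair_row (B, Z) *m projl = mxvec B by rewrite mul_projl row_mxKl.
have rE B Z : pair_row (B, Z) *m projr = mxvec Z by rewrite mul_projr row_mxKr.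
move=> ->; rewrite /quad_kernel lE rE mulmxDr (mulmxA _ projr) rE (mulmxA _ projl) lE.
rewrite mulmxDr mul_rtrans mul_ltrans !mxvecK (mul_vec_lin (mulmxr x)) /=.
by rewrite addrA !linearD.
Qed.

Lemma quad_difference_kernel x : difference_kernel (quad x) (quad_kernel x).
Proof.
apply: difference_kernel_of_cvg => [a b|a].
  rewrite /quad /quad_kernel mulmxDr !mulmxA mulmxDr !mulmxBl.
  rewrite (rtrans_ltrans (b *m projr) (a *m projl)) (rtrans_ltrans (b *m projr) (b *m projl)).
  set u1 := a *m projr *m _; set u2 := a *m projl *m ltrans _.
  set u3 := b *m projl *m ltrans _; set u4 := a *m projl *m lin_mulmxr _.
  set u5 := b *m projl *m lin_mulmxr _; clearbody u1 u2 u3 u4 u5.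
  by apply/rowP => i; rewrite !mxE; ring.
have c1 : (z.1 *m projl : 'rV[C]_N) @[z --> (a, a)] --> a *m projl.
  by apply: (@cvg_comp _ _ _ fst (mulmxr projl)); [exact: cvg_fst|exact: continuous_mulmxr].
have c2 : (z.2 *m projr : 'rV[C]_N) @[z --> (a, a)] --> a *m projr.
  by apply: (@cvg_comp _ _ _ snd (mulmxr projr)); [exact: cvg_snd|exact: continuous_mulmxr].
have d1 : rtrans (z.1 *m projl) @[z --> (a, a)] --> rtrans (a *m projl).
  exact: (cvg_comp _ _ c1 (@rtrans_continuous _)).
have d2 : ltrans (z.2 *m projr) @[z --> (a, a)] --> ltrans (a *m projr).
  exact: (cvg_comp _ _ c2 (@ltrans_continuous _ _ _)).
have e1 : projr @[z --> (a, a)] --> projr by exact: cvg_cst.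
have e2 : projl @[z --> (a, a)] --> projl by exact: cvg_cst.
have e3 : (lin_mulmxr x : 'M[C]_N) @[z --> (a, a)] --> (lin_mulmxr x : 'M[C]_N) by exact: cvg_cst.
exact: (cvgD (cvg_mulmx _ e1 d1) (cvg_mulmx _ e2 (cvgD d2 e3))).
Qed.

End PairRow.
Arguments pair_row {R n} q.
Arguments row_pair {R n} a.
Arguments projl {R n}.
Arguments projr {R n}.

(** * The chart around a point of the fibre *)

Section Chart.
Variables (R : realType) (n : nat).
Local Notation C := R[i].
Local Notation N := (n * n)%N.
Variable G : set 'M[C]_n.
Hypothesis GG : subgroup_GL G.
Hypothesis Gclosed : forall z, z \in unitmx ->
  (forall q, vanishes G q -> peval q (mxvec z) = 0) -> G z.
Local Notation g := (Lie_algebra G).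
Variables (xi eta x : 'M[C]_n) (r : nat).
Hypothesis gx : g x.
Local Notation S := (Slodowy_slice G xi eta).
Local Notation zeta := (centralizer_Lie G eta).
Hypothesis zeta_dim : has_dim zeta r.
Hypothesis Sg : forall y, S y -> g y.
Hypothesis Strans : forall y v, S y -> g v ->
  exists a b, [/\ g a, zeta b & v = lie a y + b].

Lemma zeta_lin a u v : zeta u -> zeta v -> zeta (a *: u + v).
Proof.
move=> [gu eu] [gv ev]; split; first exact: Lie_algebra_lin.
by rewrite (lie_is_linear eta) eu ev scaler0 addr0.
Qed.

Lemma slice_shift y0 y : S y0 -> (S y <-> zeta (y - y0)).
Proof.
move=> [z0 zz0 <-]; split=> [[z zz <-]|zy].
  have -> : xi + z - (xi + z0) = -1 *: z0 + z.
    by rewrite scaleN1r opprD addrACA subrr add0r addrC.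
  exact: zeta_lin.
exists (1 *: (y - (xi + z0)) + z0); first exact: zeta_lin.
by apply/matrixP => i j; rewrite !mxE; ring.
Qed.

(** In the [N + N] ambient coordinates, [c] equations define [G], [c'] the slice and [d] the fibre;
    they are independent at [p0], and [r] linear functions complete them to a local coordinate
    system. The coordinates of the first and last kind chart [G] times the slice in the order [r],
    then [d], so that the fibre is the vanishing of those of index at least [r]. *)
Lemma adapted_chart p0 : Phi_fibre G S x p0 ->
  exists (m : nat) (U : set ('M[C]_n * 'M[C]_n)) (V : set 'rV[C]_m)
         (phi : 'M[C]_n * 'M[C]_n -> 'rV[C]_m) (psi : 'rV[C]_m -> 'M[C]_n * 'M[C]_n),
    [/\ holomorphic_chart (G `*` S) U V phi psi, U p0, (r <= m)%N,
        forall q, ((G `*` S) `&` U) q ->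
            (Phi_fibre G S x q <-> forall j : 'I_m, (r <= j)%N -> phi q ord0 j = 0)
      & connected (Phi_fibre G S x `&` U)].
Proof.
case: p0 => g0 y0 [[/= Gg0 Sy0] /= Phi0].
have [Gu _ GM GV] := GG; have g0u := Gu _ Gg0.
have [c [p [d [B [Ip fB dcN BE LE]]]]] := local_equations G.
have [Bz [fBz BzE]] := has_dim_basis zeta_dim.
have [c' [Lz [rcN LzE]]] := annihilator_matrix fBz.
have y0g0 : y0 *m g0 = - (g0 *m x).
  by rewrite -Phi0 /Phi /Ad /= invmxK mulmxN opprK !mulmxA mulmxV // mul1mx.
pose one : 'rV[C]_N := mxvec 1%:M.
pose Bp := pinvmx B; have BBp : B *m Bp = 1%:M by exact: mulmxVp.
have inB X : g X -> (mxvec X *m Bp) *m B = mxvec X.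
  by move=> /BE/submxP[u ->]; rewrite -(mulmxA u) BBp mulmx1.
pose a0 := pair_row (g0, y0).
pose T0 : 'M[C]_N := lin_mulmx (invmx g0).
(* Left translation by the inverse of [g0] brings the base point to 1, where the local equations of
   [G] are available. *)
have T0E X : mxvec X *m T0 = mxvec (invmx g0 *m X) by exact: (mul_vec_lin (mulmx (invmx g0))).
pose T := projl *m T0.
have TE q : pair_row q *m T = mxvec (invmx g0 *m q.1).
  by rewrite /T mulmxA mul_projl /pair_row row_mxKl T0E.
have a0T : a0 *m T = one by rewrite TE /= mulVmx.
(* [Bp] reads coordinates in the Lie algebra and reduces the [N] components of the fibre equation to
   [d]. *)
pose T2 : 'M[C]_(N, d) := T0 *m Bp.
pose Q a := quad x a *m T2.
have QE q : Q (pair_row q) = mxvec (invmx g0 *m (q.2 *m q.1 + q.1 *m x)) *m Bp.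
  by case: q => A Y; rewrite /Q quadE /T2 mulmxA T0E.
pose KQ a b := quad_kernel x a b *m T2.
have QK : difference_kernel Q KQ.
  exact: difference_kernel_mulmxr (quad_difference_kernel x).
have Hp i : has_kernel (fun a : 'rV[C]_(N + N) => peval (p i) (a *m T))
    (fun a => T *m pgrad (p i) (a *m T)).
  exact: has_kernel_comp (peval_has_kernel _).
have [KP [PK KPd]] := kernel_family Hp.
have KP0 : KP a0 a0 = T *m pjacobian p one.
  rewrite KPd a0T; apply/matrixP => k i; rewrite !mxE; apply: eq_bigr => l _.
  by rewrite !mxE.
pose Kl := projr *m Lz.
pose K2 : 'M[C]_(N + N, d + (c + c')) := row_mx (KQ a0 a0) (row_mx (KP a0 a0) Kl).
(* conjugation by [g0] turns the differential of the quadratic part into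
   [(X, b) |-> b - [X, y0]], which is onto by transversality *)
have K2s (u : 'rV[C]_(d + (c + c'))) : exists v, v *m K2 = u.
  have KQE U V : pair_row (U, V) *m KQ a0 a0 =
      mxvec (invmx g0 *m (V *m g0 + y0 *m U + U *m x)) *m Bp.
    by rewrite mulmxA (quad_kernelE x g0 y0 (erefl (pair_row (U, V)))) mulmxA T0E.
  have KPE U V : pair_row (U, V) *m KP a0 a0 = mxvec (invmx g0 *m U) *m pjacobian p one.
    by rewrite KP0 mulmxA TE.
  have KlE U V : pair_row (U, V) *m Kl = mxvec V *m Lz.
    by rewrite mulmxA mul_projr /pair_row row_mxKr.
  (* [v1] attains the prescribed values of the equations of [G] and of the slice. The error [w] left
     in the fibre block is then corrected by a vector tangent to [G] times the slice, which leaves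
     those values unchanged. *)
  have [X1 X1E] := surjective_of_kernel fB dcN LE (lsubmx (rsubmx u)).
  have [Y1 Y1E] := surjective_of_kernel fBz rcN LzE (rsubmx (rsubmx u)).
  pose v1 := pair_row (g0 *m vec_mx X1, vec_mx Y1).
  pose w := vec_mx ((lsubmx u - v1 *m KQ a0 a0) *m B) : 'M[C]_n.
  have gw : g w by apply/BE; rewrite vec_mxK submxMl.
  have [a [b [ga zb wE]]] := Strans Sy0 (Lie_algebra_Ad GG Gg0 gw).
  pose a' := - (invmx g0 *m a *m g0).
  have ga' : g a'.
    have := Lie_algebra_Ad GG (GV _ Gg0) ga; rewrite /Ad invmxK => gAd.
    by rewrite /a' -scaleN1r -[_ *: _]addr0; apply: Lie_algebra_lin => //; exact: Lie_algebra0.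
  have a'E : invmx g0 *m (b *m g0 + y0 *m (g0 *m a') + g0 *m a' *m x) = w.
    have g0a' : g0 *m a' = - (a *m g0) by rewrite mulmxN !mulmxA mulmxV // mul1mx.
    have g0x : g0 *m x = - (y0 *m g0) by rewrite y0g0 opprK.
    rewrite g0a' mulmxN mulNmx -[a *m g0 *m x]mulmxA g0x mulmxN opprK !mulmxA.
    have -> : b *m g0 - y0 *m a *m g0 + a *m y0 *m g0 = (lie a y0 + b) *m g0.
      by rewrite /lie mulmxDl mulmxBl addrC addrA addrAC.
    by rewrite -wE /Ad !mulmxA mulVmx // mul1mx mulmxKV.
  exists (v1 + pair_row (g0 *m a', b)).
  rewrite mul_mx_row mulmxDl (KQE (g0 *m a') b) a'E {1}/w vec_mxK.
  rewrite -(mulmxA (_ - _)) BBp mulmx1 addrC subrK.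
  rewrite mul_mx_row !mulmxDl !KPE !KlE !mulmxA mulVmx // !mul1mx !vec_mxK X1E Y1E.
  have -> : mxvec a' *m pjacobian p one = 0 by apply/LE/BE.
  have -> : mxvec b *m Lz = 0 by apply/LzE/BzE.
  by rewrite !addr0 !hsubmxK.
(* From [d + c = N] for the group and [r + c' = N] for the slice; this makes the completed system
   square. *)
have rN : (r + (d + (c + c')) = N + N)%N by lia.
have [L Linj] := complete_to_injective rN K2s.
pose f1 a := row_mx ((a - a0) *m L) (Q a).
pose f2 (a : 'rV[C]_(N + N)) := row_mx (\row_i peval (p i) (a *m T)) ((a - a0) *m Kl).
pose f a := row_mx (f1 a) (f2 a).
have fK : difference_kernel f (fun a b => row_mx (row_mx L (KQ a b)) (row_mx (KP a b) Kl)) :=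
  difference_kernel_row_mx
   (difference_kernel_row_mx (difference_kernel_affine a0 L) QK)
   (difference_kernel_row_mx PK (difference_kernel_affine a0 Kl)).
have Kinj (v : 'rV[C]_(N + N)) :
    v *m row_mx (row_mx L (KQ a0 a0)) (row_mx (KP a0 a0) Kl) = 0 -> v = 0.
  rewrite !mul_mx_row -[0]row_mx0 => /eq_row_mx[].
  rewrite -[0 in X in X -> _]row_mx0 -[0 in X in _ -> X -> _]row_mx0.
  move=> /eq_row_mx[vL vQ] /eq_row_mx[vP vl]; apply: Linj => //.
  by rewrite !mul_mx_row vQ vP vl !row_mx0.
have rN' : (N + N = (r + d) + (c + c'))%N by rewrite -rN; lia.
have [J [KJ JK]] := square_inverse rN' Kinj.
have G1 : G 1%:M by case: GG.
have fa0 : f a0 = 0.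
  rewrite /f /f1 /f2 subrr !mul0mx QE /= y0g0 addNr mulmx0 linear0 mul0mx a0T.
  have -> : (\row_i peval (p i) one) = 0 by apply/rowP => i; rewrite !mxE Ip.
  by rewrite !row_mx0.
have [Z1 Z1n Z1P] := local_zero_locus GG Ip fB dcN BE LE.
have [k2 k20 O2] : exists2 k : C, 0 <= k & \forall z \near one, forall v : 'rV[C]_d,
    `|v| <= k * `|v *m (B *m ltrans z *m Bp)|.
  have Bc : B @[z --> one] --> B by apply: cst_continuous.
  have Bpc : Bp @[z --> one] --> Bp by apply: cst_continuous.
  have Ac := cvg_mulmx _ (cvg_mulmx _ Bc (@ltrans_continuous R n one)) Bpc.
  have Ac' : {for one, continuous (fun z => B *m ltrans z *m Bp)} by exact: Ac.
  apply: (near_left_injective (J := 1%:M) Ac').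
  by rewrite ltrans1 !mulmx1.
have [k3 k30 O3] : exists2 k : C, 0 <= k & \forall z \near one, forall v : 'rV[C]_n,
    `|v| <= k * `|v *m vec_mx z|.
  have vc : {for one, continuous (vec_mx : 'rV[C]_N -> 'M[C]_n)}.
    exact: linear_rV_continuous.
  by apply: (near_left_injective (J := 1%:M) vc); rewrite mxvecK mulmx1.
(* The three conditions are used to recover membership in [G] from the local equations, to recover
   the fibre equation from its [d] projected components, and to keep the group variable
   invertible. *)
pose O : set 'rV[C]_(N + N) := [set a |
  [/\ Z1 (a *m T), forall v : 'rV[C]_d, `|v| <= k2 * `|v *m (B *m ltrans (a *m T) *m Bp)|
    & forall v : 'rV[C]_n, `|v| <= k3 * `|v *m vec_mx (a *m T)|]].
have On : nbhs a0 O.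
  have pull (Z : set 'rV[C]_N) : nbhs one Z -> nbhs a0 [set a | Z (a *m T)].
    by rewrite -a0T => HZ; exact: (@continuous_mulmxr _ 1 _ _ T a0 _ HZ).
  have H1 := pull _ Z1n; have H2 := pull _ O2; have H3 := pull _ O3.
  by near=> a; split; near: a.
have [U [e [h [[oU Ua0 UO e0] fU hU dh]]]] := inverse_function fK KJ JK On.
pose phi q := f1 (pair_row q).
pose psi (v : 'rV[C]_(r + d)) := row_pair (h (row_mx v 0)).
have f2M q : (G `*` S) q -> f2 (pair_row q) = 0.
  case: q => A Y [/= GA SY].
  have -> : f2 (pair_row (A, Y)) = row_mx 0 0 by congr row_mx;
    [apply/rowP => i; rewrite !mxE TE Ip //=; apply: (GM) => //; exact: GV
    |rewrite mulmxA mul_projr linearB /= /pair_row !row_mxKr -linearB /=;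
     apply/LzE/BzE/slice_shift].
  exact: row_mx0.
have f2U a : U a -> f2 a = 0 -> (G `*` S) (row_pair a).
  move=> /UO[Za _ ia]; rewrite /f2 -[0]row_mx0 => /eq_row_mx[Pa la].
  have aTE : a *m T = mxvec (invmx g0 *m vec_mx (lsubmx a)) by rewrite -{1}[a]row_pairK TE.
  have zu : invmx g0 *m vec_mx (lsubmx a) \in unitmx.
    rewrite -row_free_unit; apply: inj_row_free => v v0; apply/eqP.
    by rewrite -normr_le0; have := ia v; rewrite aTE mxvecK v0 normr0 mulr0.
  split=> /=.
    have Gz : G (invmx g0 *m vec_mx (lsubmx a)).
      apply: Gclosed => // q Iq; rewrite -aTE; apply: Z1P => // i.
      by have /rowP/(_ i) := Pa; rewrite !mxE.
    by have := GM _ _ Gg0 Gz; rewrite mulmxA mulmxV // mul1mx.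
  apply/(slice_shift _ Sy0)/BzE/LzE; rewrite linearB /= vec_mxK.
  by move: la; rewrite mulmxA mul_projr linearB /= /pair_row row_mxKr.
(* At [(A, Y)] the fibre equation is [z = 0] with [z = A^-1 Y A + x] in the Lie algebra, while [Q]
   gives the [Bp]-coordinates of [g0^-1 A z]. Since [g0^-1 A] is close to 1, these determine [z]. *)
have fibreE q : (G `*` S) q -> U (pair_row q) ->
    (Phi_fibre G S x q <-> Q (pair_row q) = 0).
  case: q => A Y [/= GA SY] UA; have Au := Gu _ GA.
  pose z := invmx A *m Y *m A + x.
  have gz : g z.
    have := Lie_algebra_Ad GG (GV _ GA) (Sg SY); rewrite /Ad invmxK => gAd.
    by rewrite /z -[_ *m A]scale1r; exact: Lie_algebra_lin.
  have zE : Y *m A + A *m x = A *m z.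
    by rewrite mulmxDr !mulmxA mulmxV // mul1mx.
  have PhiE : Phi (A, Y) = x <-> z = 0.
    rewrite /Phi /Ad /= invmxK; split=> [H|/eqP]; first by rewrite /z -H subrr.
    by rewrite addr_eq0 => /eqP ->; rewrite opprK.
  rewrite QE /= zE; split=> [[_ /PhiE ->]|Q0]; first by rewrite !mulmx0 linear0 mul0mx.
  split=> //; apply/PhiE; have [_ ia _] := UO _ UA.
  have := ia (mxvec z *m Bp).
  have -> : mxvec z *m Bp *m (B *m ltrans (pair_row (A, Y) *m T) *m Bp) = 0.
    rewrite mulmxA (mulmxA _ B) (inB z gz) TE /= mul_ltrans mxvecK -Q0.
    by rewrite -!mulmxA.
  rewrite normr0 mulr0 normr_le0 => /eqP z0.
  by rewrite -[z]mxvecK -inB // z0 mul0mx linear0.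
have phij q : (forall j : 'I_(r + d), (r <= j)%N -> phi q ord0 j = 0) <-> Q (pair_row q) = 0.
  split=> [H|Q0 j rj].
    apply/rowP => j; have := H (rshift r j) (leq_addr _ _).
    by rewrite /phi /f1 row_mxEr => ->; rewrite mxE.
  rewrite /phi /f1 Q0; case: (split_ordP j) rj => k ->; last by rewrite row_mxEr mxE.
  by rewrite /= leqNgt ltn_ord.
exists (r + d)%N, (pair_row @^-1` U), [set v | `|v| < e], phi, psi.
have ve v : `|v| < e -> `|f a0 - row_mx v 0| < e.
  move=> vlt; rewrite fa0 sub0r normrN; apply: le_lt_trans vlt.
  apply: mx_norm_leP => // i j; rewrite mxE; case: (fintype.split j) => k.
    exact: mx_norm_entry.
  by rewrite mxE normr0.
have chartM q : ((G `*` S) `&` (pair_row @^-1` U)) q -> `|phi q| < e /\ psi (phi q) = q.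
  move=> [Mq Uq]; have [fq hq] := fU _ Uq.
  have fE : f (pair_row q) = row_mx (phi q) 0 by rewrite /f f2M.
  split; last by rewrite /psi -fE hq pair_rowK.
  apply: le_lt_trans fq; rewrite fa0 sub0r normrN fE; apply: mx_norm_leP => // i j.
  by rewrite -(row_mxEl (phi q) (0 : 'M[C]_(1, c + c'))) mx_norm_entry.
have chartV v : `|v| < e -> ((G `*` S) `&` (pair_row @^-1` U)) (psi v) /\ phi (psi v) = v.
  move=> /ve vlt; have [Ua fa] := hU _ vlt.
  have [f1v f2v] := eq_row_mx fa.
  by rewrite /phi /= /psi row_pairK; split=> //; split=> //; exact: f2U.
have psid v : `|v| < e -> differentiable psi v.
  move=> /ve vlt; have [D _ hd] := dh _ vlt.
  pose emb (v : 'rV[C]_(r + d)) : 'rV[C]_((r + d) + (c + c')) := row_mx v 0.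
  have embl : linear emb by move=> k u w; rewrite scale_row_mx add_row_mx scaler0 addr0.
  pose l : {linear 'rV[C]_(r + d) -> 'rV[C]_((r + d) + (c + c'))} :=
    HB.pack emb (GRing.isLinear.Build _ _ _ _ _ embl).
  have dl : differentiable l v.
    exact/linear_differentiable/linear_rV_continuous.
  have dhl : differentiable (h \o l) v by exact: differentiable_comp.
  exact: (differentiable_comp dhl (row_pair_differentiable _)).
have Vo : open [set v : 'rV[C]_(r + d) | `|v| < e].
  have -> : [set v : 'rV[C]_(r + d) | `|v| < e] = ball 0 e.
    by apply/seteqP; split=> v /=; rewrite -ball_normE /= sub0r normrN.
  exact: ball_open.
have phid q : differentiable phi q.
  have [f1d _] := difference_kernel_is_diff (pair_row q)
    (difference_kernel_row_mx (difference_kernel_affine a0 L) QK).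
  exact: (differentiable_comp (pair_row_differentiable q) f1d).
split.
- split => //; split=> //.
  by apply: open_comp => // q _; exact: pair_row_continuous.
- by [].
- exact: leq_addr.
- by move=> q [Mq Uq]; rewrite phij; exact: fibreE.
pose V0 := [set v : 'rV[C]_(r + d) | `|v| < e /\
  forall j : 'I_(r + d), (r <= j)%N -> v ord0 j = 0].
have -> : Phi_fibre G S x `&` (pair_row @^-1` U) = psi @` V0.
  apply/seteqP; split=> [q [Fq Uq]|_ [v [vlt v0] <-]].
    have Mq : (G `*` S) q by case: Fq.
    have [qlt qE] := chartM q (conj Mq Uq); exists (phi q) => //; split=> //.
    exact/phij/fibreE.
  have [[Mv Uv] phv] := chartV v vlt; split=> //.
  by apply/fibreE => //; apply/phij; rewrite phv.
(* The part of the fibre in the chart is the continuous image of a ball cut by a coordinate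
   subspace, which is star-shaped about 0. *)
apply: connected_continuous_connected.
  apply: star_connected => [|v t [vlt v0] /andP[t0 t1]].
    by split=> [|j _]; rewrite ?normr0 // mxE.
  split=> [|j rj]; last by rewrite mxE v0 // mulr0.
  rewrite normrZ normc_real ger0_norm //; apply: le_lt_trans vlt.
  by rewrite ler_piMl // lecR.
apply: continuous_in_subspaceT => v; rewrite inE => -[vlt _].
exact/differentiable_continuous/psid.
Unshelve. all: by end_near. Qed.

End Chart.

(** * The fibre and its connected components *)

Unset Implicit Arguments.

Theorem corollary7 (R : realType) (n : nat) (G : set 'M[R[i]]_n)
  (G_alg : linear_algebraic_group G)
  (G_connected : connected G)
  (G_simply_connected : simply_connected R G)
  (G_semisimple : semisimple_group G)
  (rk : nat) (rkG : has_rank G rk)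
  (Oreg : set 'M[R[i]]_n) (OregP : regular_nilpotent_orbit G rk Oreg)
  (xi h eta : 'M[R[i]]_n)
  (triple : sl2_triple G xi h eta) (xi_reg : Oreg xi) (eta_reg : Oreg eta)
  (x : 'M[R[i]]_n) (x_reg : regular_elements G rk x) :
  let Sreg := Slodowy_slice G xi eta in
  let fibre := Phi_fibre G Sreg x in
  complex_submanifold (G `*` Sreg) fibre rk /\
  (forall p, fibre p ->
     complex_submanifold (G `*` Sreg) (connected_component fibre p) rk).
Proof.
move=> Sreg fibre; case: G_alg => GG [I GE].
(* The defining equations of [G] are among the polynomials vanishing on it, so the whole vanishing
   ideal may replace them. *)
have Gclosed z : z \in unitmx ->
    (forall q, vanishes G q -> peval q (mxvec z) = 0) -> G z.
  move=> zu vz; rewrite GE; split=> // p Ip; apply: vz => a.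
  by rewrite GE => -[_]; apply.
have zeta_dim : has_dim (centralizer_Lie G eta) rk by have [] := OregP.2 eta eta_reg.
have Strans y v : Sreg y -> Lie_algebra G v -> exists a b,
    [/\ Lie_algebra G a, centralizer_Lie G eta b & v = lie a y + b].
  apply: (slice_transversal GG triple).
    exact: (nilpotent_orbit_ad GG OregP xi_reg).
  exact: (nilpotent_orbit_ad GG OregP eta_reg).
have Sg y : Sreg y -> Lie_algebra G y by move=> Sy; exact: slice_sub triple Sy.
have gx : Lie_algebra G x by case: x_reg.
have chart := adapted_chart GG Gclosed gx zeta_dim Sg Strans.
split.
  split=> [p []//|p /chart[m [U [V [phi [psi [ch Up rm ifib _]]]]]]].
  by exists m, U, V, phi, psi.
move=> p0 Fp0; split=> [q /connected_component_sub[]//|p p0p].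
have Fp : fibre p := connected_component_sub p0p.
have [m [U [V [phi [psi [ch Up rm ifib conn]]]]]] := chart p Fp.
exists m, U, V, phi, psi; split=> // q Mq; rewrite -ifib //.
split=> [/connected_component_sub//|Fq].
(* With the component based at the centre [p] of the chart, the connected set where the fibre meets
   [U] lies inside it; there the component and the fibre satisfy the same equations. *)
rewrite (same_connected_component p0p).
have sub : fibre `&` U `<=` connected_component fibre p.
  by apply: connected_component_max => // z [].
by apply: sub; split=> //; case: Mq.
Qed.
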